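(* Let $\mathfrak{v}$ be a finite dimensional Euclidean space and let $G\subseteq\mathrm{O}(\mathfrak{v})$ be a compact group. If $G$ is polar with Cartan subspace $\mathfrak{a}$ and Weyl group $W$, then the mapping $A\mapsto A\cap\mathfrak{a}$ is a semigroup isomorphism between $\mathfrak{C}(\mathfrak{v},G)$ and $\mathfrak{C}(\mathfrak{a},W)$.
   Context: $O_v=Gv$ is the $G$-orbit of $v\in\mathfrak{v}$. $G$ (not assumed connected) is polar if there is a linear subspace $\mathfrak{a}\subseteq\mathfrak{v}$ (a Cartan subspace) such that (A) each orbit $O_v$, $v\in\mathfrak{v}$, meets $\mathfrak{a}$; (B) for each $u\in\mathfrak{a}$ the tangent space $T_uO_u$ is orthogonal to $\mathfrak{a}$. The Weyl group is $W=\{g\in G: g\mathfrak{a}=\mathfrak{a}\}\big|_{\mathfrak{a}}$, the group of restrictions to $\mathfrak{a}$. For a real vector space $\mathfrak{l}$ and a subgroup $H\subseteq\mathrm{GL}(\mathfrak{l})$, $\mathfrak{C}(\mathfrak{l},H)$ denotes the family of all $H$-invariant convex sets in $\mathfrak{l}$, which is a semigroup under Minkowski addition $A+B=\{a+b:a\in A,\ b\in B\}$. *)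

(* Defs.v *)
From HB Require Import structures.
From mathcomp Require Import all_boot all_order all_algebra.
From mathcomp Require Import all_classical all_reals.
From mathcomp Require Import topology normedtype derive convex.

Set Implicit Arguments.
Unset Strict Implicit.
Unset Printing Implicit Defensive.

Import Order.TTheory GRing.Theory Num.Theory.
Import numFieldNormedType.Exports.

Local Open Scope classical_set_scope.
Local Open Scope ring_scope.

Definition is_semigroup (T : Type) (op : T -> T -> T) (S : set T) : Prop :=
  (forall x y, S x -> S y -> S (op x y)) /\
  (forall x y z, S x -> S y -> S z -> op x (op y z) = op (op x y) z).

Definition is_semigroup_iso (T T' : Type) (op : T -> T -> T) (S : set T)
    (op' : T' -> T' -> T') (S' : set T') (f : T -> T') : Prop :=
  [/\ is_semigroup op S, is_semigroup op' S', set_bij S S' f &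
      forall x y, S x -> S y -> f (op x y) = op' (f x) (f y)].

Section invariant_convex_sets.
Variables (R : realType) (L : vectType R).

Definition minkowski_add (A B : set L) : set L :=
  [set a + b | a in A & b in B].

(* The empty set is a member. *)
Definition invariant_convex (H : set 'End(L)) : set (set L) :=
  [set A | convex_set (A : set (convex_lmodType L)) /\
           forall h, H h -> h @` A = A].

End invariant_convex_sets.

Section polar_groups.
Variables (R : realType) (V : vectType R) (dot : {dot V for idfun}).
Implicit Types (G : set 'End(V)) (a : {vspace V}) (M : set V) (u v xi : V).

Definition orthogonal_subgroup G : Prop :=
  [/\ forall g, G g -> forall x y, dot (g x) (g y) = dot x y,
      G \1%VF,
      forall g h, G g -> G h -> G (g \o h)%VF &
      forall g, G g -> G (g^-1)%VF].

(* A vectType carries no topology: [V] and ['End(V)] get theirs from coordinates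
   in a basis of [V]; it does not depend on the basis. *)
Definition coords v : 'rV[R]_(\dim {:V}) := passmx.rVof (vbasis {:V}) v.

Definition coords_end (g : 'End(V)) : 'M[R]_(\dim {:V}) :=
  passmx.mxof (vbasis {:V}) (vbasis {:V}) g.

Definition compact_endomorphisms G : Prop :=
  compact [set coords_end g | g in G].

Definition orbit_of G v : set V := [set g v | g in G].

(* The tangent space of a submanifold [M] of [V] at [u], as the set of initial
   velocities of the curves in [M] that start at [u]. It is only applied to
   orbits of compact groups, which are embedded submanifolds; for these,
   requiring the curves to be differentiable at [0] or to be smooth yields the
   same set. *)
Definition tangent_space M u : set V :=
  [set xi | exists gamma : R -> V,
    [/\ gamma 0 = u, \forall t \near (0 : R), M (gamma t) &
        is_derive (0 : R) 1 (fun t => coords (gamma t)) (coords xi)]].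

Definition cartan_subspace G a : Prop :=
  (forall v, exists2 u, orbit_of G v u & u \in a) /\
  (forall u, u \in a -> forall xi, tangent_space (orbit_of G u) u xi ->
     forall w, w \in a -> dot xi w = 0).

(* [w] is the restriction to [a], seen as a vector space of its own, of some
   [g] in [G] that maps [a] onto itself. *)
Definition weyl_group G a : set 'End(subvs_of a) :=
  [set w | exists g, [/\ G g, (g @: a)%VS = a &
                         forall x, vsval (w x) = g (vsval x)]].

(* The intersection of [A] and [a], as a subset of the vector space [a]. *)
Definition trace_on a (A : set V) : set (subvs_of a) := vsval @^-1` A.

End polar_groups.

Arguments minkowski_add {R L} A B.
Arguments weyl_group {R V} G a _.
Arguments trace_on {R V} a A _.

(* Main.v *)
Require Import Defs.
From HB Require Import structures.
From mathcomp Require Import all_boot all_order all_algebra.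
From mathcomp Require Import all_classical all_reals.
From mathcomp Require Import topology normedtype sequences derive convex.
From mathcomp Require Import interval_inference ring lra.

(* The heart of the matter is that p = s g1 c1 + t g2 c2 in a, with ci in a and
   s, t >= 0, lies in the convex hull of the points s n c1 + t n' c2, where n
   and n' run over the g in G with g a = a (weyl_hull). Convexity of G.C and the
   identity (A + B) /\ a = (A /\ a) + (B /\ a) follow by moving a point of a sum
   into a. Since there are finitely many points s n c1 + t n' c2, it suffices
   that for w, u in a the maximum of <w, g u> over g in G is attained at some g
   with g a = a (weyl_maximizer).

   Call a subspace b commuting if X x is orthogonal to b for all x in b and all
   X in the Lie algebra of G; by (B), a is commuting. A generic x in b is
   regular: X x = 0 implies X b = 0. If z_n in b tends to such an x and k_n -> k
   in G with k_n z_n in a, then k_n z_n = k z_n (regular_limit): otherwise the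
   differences k^-1 k_n z_n - z_n, suitably rescaled, tend to some X x <> 0,
   which lies in k^-1 a + b but is orthogonal to both. Letting z_n run along a
   curve that spans b, (A) yields a k in G with k b <= a. If g maximizes
   <w, g u>, then w and g u span a commuting subspace, which can thus be moved
   into a; doing this along curves w_n -> w and u_n -> u that span a forces
   k a = a and k g a = a.

   Limits are taken along an ultrafilter on nat finer than \oo, which replaces
   the extraction of subsequences. *)

Set Implicit Arguments.
Unset Strict Implicit.
Unset Printing Implicit Defensive.

Import Order.TTheory GRing.Theory Num.Theory.
Import numFieldNormedType.Exports passmx.

Local Open Scope classical_set_scope.
Local Open Scope ring_scope.

(** * Limits along an ultrafilter *)

Section coordinate_norm.
Context {R : realType}.

(** A norm that is available on every [vectType], hence on [V] and ['End(V)] alike: one notion of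
    limit then serves both vectors and group elements. *)
Definition l1 {V : vectType R} (v : V) : R := \sum_i `|coords v 0 i|.

Section one_space.
Context {V : vectType R}.
Implicit Types u v w : V.
Let e := vbasis {:V}.
Let eb : basis_of {:V} e := vbasisP _.

Lemma l1_ge0 v : 0 <= l1 v.
Proof. by apply: sumr_ge0. Qed.

Lemma l1_eq0 v : l1 v = 0 -> v = 0.
Proof.
move=> v0; have /eqP := v0; rewrite psumr_eq0// => /allP h.
apply/eqP; rewrite -(rVof_eq0 eb); apply/eqP/rowP => i.
rewrite [RHS]mxE; apply/eqP; rewrite -normr_eq0.
exact: (h i (mem_index_enum i)).
Qed.

Lemma l1_0 : l1 (0 : V) = 0.
Proof. by apply: big1 => i _; rewrite /coords linear0 mxE normr0. Qed.

Lemma l1D u v : l1 (u + v) <= l1 u + l1 v.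
Proof.
rewrite -big_split/=; apply: ler_sum => i _.
by rewrite /coords linearD mxE ler_normD.
Qed.

Lemma l1Z (c : R) v : l1 (c *: v) = `|c| * l1 v.
Proof.
rewrite mulr_sumr; apply: eq_bigr => i _.
by rewrite /coords linearZ mxE normrM.
Qed.

Lemma l1N v : l1 (- v) = l1 v.
Proof. by rewrite -scaleN1r l1Z normrN1 mul1r. Qed.

Lemma l1B u v : l1 (u - v) <= l1 u + l1 v.
Proof. by rewrite -(l1N v) l1D. Qed.

Lemma l1_distC u v : l1 (u - v) = l1 (v - u).
Proof. by rewrite -l1N opprB. Qed.

Lemma l1_dist v u w : l1 (u - w) <= l1 (u - v) + l1 (v - w).
Proof. by apply: le_trans (l1D _ _); rewrite addrA subrK. Qed.

Lemma vbasis_sum v : v = \sum_i coords v 0 i *: e`_i.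
Proof. by rewrite -[LHS](rVofK eb). Qed.

Lemma normr_coords v : `|coords v| <= l1 v.
Proof.
rewrite /Num.norm/= mx_normrE; apply/bigmax_leP; split=> [|[i j] _ /=].
  exact: l1_ge0.
rewrite ord1 /l1 (bigD1 j)//= lerDl; exact: sumr_ge0.
Qed.

End one_space.

Section bounds.
Context {U V : vectType R} {W : lmodType R} (p : W -> R).
Hypothesis pD : forall x y, p (x + y) <= p x + p y.
Hypothesis pZ : forall (c : R) x, p (c *: x) = `|c| * p x.

Lemma seminorm_sum n (F : 'I_n -> W) :
  p (\sum_i F i) <= \sum_i p (F i).
Proof.
elim/big_ind2: _ => //; first by rewrite -(scale0r 0) pZ normr0 mul0r.
by move=> x1 x2 y1 y2 h1 h2; apply: le_trans (pD _ _) _; apply: lerD.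
Qed.

Lemma seminorm_ge0 x : 0 <= p x.
Proof.
have := pD x (- x); rewrite subrr -[X in p X](scale0r 0) pZ normr0 mul0r.
by rewrite -scaleN1r pZ normrN1 mul1r; lra.
Qed.

Lemma linear_bounded (f : {linear U -> W}) :
  exists2 K : R, 0 < K & forall u, p (f u) <= K * l1 u.
Proof.
exists (1 + \sum_(i < \dim {:U}) p (f (vbasis {:U})`_i)).
  by rewrite ltr_pwDl// sumr_ge0// => i _; exact: seminorm_ge0.
move=> u; rewrite {1}(vbasis_sum u) linear_sum.
apply: le_trans (seminorm_sum _) _.
rewrite mulrDl mul1r -[leLHS]add0r lerD ?l1_ge0// mulr_suml ler_sum// => i _.
rewrite linearZ pZ mulrC ler_wpM2l ?seminorm_ge0//.
by rewrite /l1 (bigD1 i)//= lerDl; exact: sumr_ge0.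
Qed.

End bounds.

(** Apply [linear_bounded] first in [u], with [v] a basis vector, and then expand [v] in the basis.
    The seminorm [p] stands for [l1] on vectors and endomorphisms and for the absolute value in the
    case of the inner product. *)
Lemma bilinear_bounded {U V : vectType R} {W : lmodType R} (p : W -> R)
    (pD : forall x y, p (x + y) <= p x + p y)
    (pZ : forall (c : R) x, p (c *: x) = `|c| * p x)
    (f : U -> V -> W) :
  (forall u, linear (f u)) -> (forall v, linear (f^~ v)) ->
  exists2 K : R, 0 < K & forall u v, p (f u v) <= K * l1 u * l1 v.
Proof.
move=> fl fr.
have fle (u : U) : exists2 K : R, 0 < K & forall v, p (f u v) <= K * l1 v.
  pose g : {linear V -> W} := HB.pack (f u)
    (GRing.isLinear.Build _ _ _ _ _ (fl u)).
  exact: (linear_bounded pD pZ g).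
pose q u := \sum_(j < \dim {:V}) p (f u (vbasis {:V})`_j).
have [K K0 qK] : exists2 K : R, 0 < K & forall u, q u <= K * l1 u.
  have /fin_all_exists2[K K0 fK] (j : 'I_(\dim {:V})) : exists2 K : R, 0 < K &
      forall u, p (f u (vbasis {:V})`_j) <= K * l1 u.
    pose g : {linear U -> W} := HB.pack (f^~ (vbasis {:V})`_j)
      (GRing.isLinear.Build _ _ _ _ _ (fr _)).
    exact: (linear_bounded pD pZ g).
  exists (1 + \sum_j K j).
    by rewrite ltr_pwDl// sumr_ge0// => j _; exact: ltW.
  move=> u; rewrite mulrDl mul1r -[leLHS]add0r lerD ?l1_ge0//.
  by rewrite mulr_suml ler_sum.
exists K => // u v.
pose g : {linear V -> W} := HB.pack (f u)
  (GRing.isLinear.Build _ _ _ _ _ (fl u)).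
rewrite -[f u v]/(g v) {1}(vbasis_sum v) linear_sum.
apply: le_trans (seminorm_sum pD pZ _) _.
apply: (@le_trans _ _ (q u * l1 v)); last by rewrite ler_wpM2r ?l1_ge0.
rewrite mulr_suml ler_sum// => i _.
rewrite linearZ pZ mulrC ler_wpM2l ?(seminorm_ge0 pD)//.
by rewrite /l1 (bigD1 i)//= lerDl; exact: sumr_ge0.
Qed.

End coordinate_norm.

Section ultralimit.
Context {R : realType} (U : set_system nat) {UF : UltraFilter U}.

Definition ulim {V : vectType R} (x : nat -> V) (l : V) : Prop :=
  l1 (x n - l) @[n --> U] --> (0 : R).

(** A cluster point of an ultrafilter is a limit: otherwise the image of [U] would contain the
    complement of some neighbourhood of the point, which must however meet that neighbourhood. *)
Lemma ultra_compact {T : topologicalType} (K : set T) (x : nat -> T) :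
  compact K -> (\forall n \near U, K (x n)) ->
  exists2 l, K l & x n @[n --> U] --> l.
Proof.
move=> Kc xK; have [l [Kl cl]] := Kc (x @ U) _ xK.
exists l => // B Bl; have [//|nB] := in_ultra_setVsetC (x @^-1` B) UF.
by have [y [nBy /nBy]] := cl (~` B) B nB Bl.
Qed.

Lemma ultra_bounded_cvg (x : nat -> R) (C : R) :
  (\forall n \near U, `|x n| <= C) -> exists l : R, x n @[n --> U] --> l.
Proof.
move=> xC; have [|l _ ?] := @ultra_compact _ _ x (@segment_compact R (- C) C).
  by apply: filterS xC => n; rewrite /= in_itv/= ler_norml.
by exists l.
Qed.

Lemma cvg_le0 (x y : nat -> R) : (\forall n \near U, 0 <= x n <= y n) ->
  y n @[n --> U] --> (0 : R) -> x n @[n --> U] --> (0 : R).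
Proof.
by move=> xy y0; apply: (squeeze_cvgr xy) => //; exact: cvg_cst.
Qed.

Lemma cvg_dist_le (x y : nat -> R) (l : R) :
  (\forall n \near U, `|x n - l| <= y n) ->
  y n @[n --> U] --> (0 : R) -> x n @[n --> U] --> l.
Proof.
move=> xy y0.
apply: (@squeeze_cvgr _ _ _ _ (fun n => l - y n) (fun n => l + y n)).
- by apply: filterS xy => n; rewrite ler_distl.
- by rewrite -[X in _ --> X](subr0 l); apply: cvgB => //; exact: cvg_cst.
- by rewrite -[X in _ --> X](addr0 l); apply: cvgD => //; exact: cvg_cst.
Qed.

Lemma cvg_sumr n (F : 'I_n -> nat -> R) (l : 'I_n -> R) :
  (forall i, F i k @[k --> U] --> l i) ->
  \sum_i F i k @[k --> U] --> \sum_i l i.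
Proof.
elim: n F l => [|n IH] F l Fl.
  rewrite big_ord0; under eq_fun do rewrite big_ord0; exact: cvg_cst.
rewrite big_ord_recr/=; under eq_fun do rewrite big_ord_recr/=.
by apply: cvgD; [exact: IH|exact: Fl].
Qed.

Section one_space.
Context {V : vectType R}.
Implicit Types (x y : nat -> V) (l m : V).

Lemma ulim_le x l (y : nat -> R) : (\forall n \near U, l1 (x n - l) <= y n) ->
  y n @[n --> U] --> (0 : R) -> ulim x l.
Proof.
by move=> h; apply: cvg_le0; apply: filterS h => n ->; rewrite l1_ge0.
Qed.

Lemma ulim_cst l : ulim (fun=> l) l.
Proof. by rewrite /ulim subrr l1_0; exact: cvg_cst. Qed.

Lemma ulimD x y l m : ulim x l -> ulim y m -> ulim (fun n => x n + y n) (l + m).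
Proof.
move=> xl ym; apply: (@ulim_le _ _ (fun n => l1 (x n - l) + l1 (y n - m))).
  by apply: nearW => n; rewrite opprD addrACA l1D.
by rewrite -(addr0 0); exact: cvgD.
Qed.

Lemma ulimN x l : ulim x l -> ulim (fun n => - x n) (- l).
Proof.
move=> xl; apply: ulim_le xl; apply: nearW => n.
by rewrite -opprD l1N.
Qed.

Lemma ulimB x y l m : ulim x l -> ulim y m -> ulim (fun n => x n - y n) (l - m).
Proof. by move=> xl ym; apply: ulimD => //; exact: ulimN. Qed.

Lemma near_ulim x y l : (\forall n \near U, x n = y n) -> ulim x l -> ulim y l.
Proof.
by move=> xy xl; apply: ulim_le xl; apply: filterS xy => n ->.
Qed.

Lemma ulim_l1 x l : ulim x l -> l1 (x n) @[n --> U] --> l1 l.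
Proof.
move=> xl; apply: cvg_dist_le xl.
apply: nearW => n; rewrite ler_norml; apply/andP; split.
  have := l1_dist (x n) l 0; rewrite !subr0 (l1_distC l); lra.
by have := l1_dist l (x n) 0; rewrite !subr0; lra.
Qed.

Lemma ulim_unique x l m : ulim x l -> ulim x m -> l = m.
Proof.
move=> xl xm; apply/eqP; rewrite -subr_eq0; apply/eqP/l1_eq0/eqP.
rewrite eq_le l1_ge0 andbT.
apply: (cvgr_to_le (ulim_l1 (ulimB xl xm))).
by apply: nearW => n; rewrite subrr l1_0.
Qed.

Lemma ulimZ (c : nat -> R) (d : R) x l : c n @[n --> U] --> d -> ulim x l ->
  ulim (fun n => c n *: x n) (d *: l).
Proof.
move=> cd xl.
apply: (@ulim_le _ _ (fun n => `|c n| * l1 (x n - l) + `|c n - d| * l1 l)).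
  apply: nearW => n; rewrite -!l1Z; apply: le_trans (l1D _ _).
  by rewrite scalerBr scalerBl addrA subrK.
have -> : 0 = `|d| * 0 + `|d - d| * l1 l :> R.
  by rewrite subrr normr0 mulr0 mul0r addr0.
apply: cvgD; first by apply: cvgM => //; exact: cvg_norm.
by apply: cvgMr_tmp; apply: cvg_norm; apply: cvgB => //; exact: cvg_cst.
Qed.

Lemma near_ulim_lt x l (eps : R) : 0 < eps -> ulim x l ->
  \forall n \near U, l1 (x n - l) < eps.
Proof. by move=> e0 /cvgr_lt; exact. Qed.

Lemma ulim_bounded x l : ulim x l -> \forall n \near U, l1 (x n) <= l1 l + 1.
Proof.
move=> /(near_ulim_lt ltr01); apply: filterS => n h.
by have := l1_dist l (x n) 0; rewrite !subr0; lra.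
Qed.

(** Bolzano-Weierstrass, coordinate by coordinate; an ultrafilter makes all coordinates converge at
    once. *)
Lemma bounded_ulim x (C : R) : (\forall n \near U, l1 (x n) <= C) ->
  exists l, ulim x l.
Proof.
move=> xC; have /choice[c cl] (i : 'I_(\dim {:V})) :
    exists c : R, coords (x n) 0 i @[n --> U] --> c.
  apply: (@ultra_bounded_cvg _ C); apply: filterS xC => n; apply: le_trans.
  by rewrite /l1 (bigD1 i)//= lerDl; exact: sumr_ge0.
exists (vecof (vbasis {:V}) (\row_i c i)).
have := @cvg_sumr _
  (fun i k => `|coords (x k - vecof (vbasis {:V}) (\row_i c i)) 0 i|)
  (fun=> 0).
rewrite big1//; apply=> i.
have -> : 0 = `|c i - c i| :> R by rewrite subrr normr0.
apply: cvg_norm; apply: cvg_trans (cvgB (cl i) (cvg_cst (c i))).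
rewrite (_ : (fun n => _) = (fun n => coords (x n) 0 i - c i))//.
by apply/funext => n; rewrite /coords linearB/= (vecofK (vbasisP _)) !mxE.
Qed.

End one_space.

Lemma ulim_linear {V W : vectType R} (f : {linear V -> W}) x l :
  ulim x l -> ulim (fun n => f (x n)) (f l).
Proof.
move=> xl; have [K K0 fK] := linear_bounded (@l1D R W) (@l1Z R W) f.
apply: (@ulim_le _ _ _ (fun n => K * l1 (x n - l))).
  by apply: nearW => n; rewrite -linearB.
by rewrite -(mulr0 K); exact: cvgMl_tmp.
Qed.

Lemma ulim_bilinear {V V' W : vectType R} (f : V -> V' -> W) x y l m :
  (forall u, linear (f u)) -> (forall v, linear (f^~ v)) ->
  ulim x l -> ulim y m -> ulim (fun n => f (x n) (y n)) (f l m).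
Proof.
move=> fl fr xl ym.
have [K K0 fK] := bilinear_bounded (@l1D R W) (@l1Z R W) fl fr.
apply: (@ulim_le _ _ _
  (fun n => K * l1 (x n) * l1 (y n - m) + K * l1 (x n - l) * l1 m)).
  apply: nearW => n.
  apply: le_trans (lerD (fK _ _) (fK _ _)); apply: le_trans (l1D _ _).
  pose g : {linear V' -> W} := HB.pack (f (x n))
    (GRing.isLinear.Build _ _ _ _ _ (fl (x n))).
  pose h : {linear V -> W} := HB.pack (f^~ m)
    (GRing.isLinear.Build _ _ _ _ _ (fr m)).
  rewrite -[f (x n) (y n - m)]/(g _) -[f (x n - l) m]/(h _) !linearB/=.
  by rewrite addrA subrK.
have -> : 0 = K * l1 l * 0 + K * 0 * l1 m :> R.
  by rewrite !mulr0 mul0r addr0.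
apply: cvgD; first by apply: cvgM => //; apply: cvgMl_tmp; exact: ulim_l1.
by apply: cvgMr_tmp; exact: cvgMl_tmp.
Qed.

End ultralimit.

Section matrix_bound.
Context {R : realType} {V : vectType R}.

Lemma normr_entry_le m n (A : 'M[R]_(m, n)) i j : `|A i j| <= `|A|.
Proof.
rewrite [leRHS]/Num.norm/= mx_normrE.
exact: (le_bigmax _ (fun ij : 'I_m * 'I_n => `|A ij.1 ij.2|) (i, j)).
Qed.

(** Compactness of G is stated for matrices with their maximum norm; this bound carries convergence
    over to [l1]. *)
Lemma matrix_bounded m n (f : {linear 'M[R]_(m, n) -> V}) :
  exists K : R, forall A, l1 (f A) <= K * `|A|.
Proof.
exists (\sum_i \sum_j l1 (f (delta_mx i j))) => A.
rewrite {1}[A]matrix_sum_delta linear_sum mulr_suml.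
apply: le_trans (seminorm_sum (@l1D R V) (@l1Z R V) _) _.
apply: ler_sum => i _; rewrite linear_sum mulr_suml.
apply: le_trans (seminorm_sum (@l1D R V) (@l1Z R V) _) _.
apply: ler_sum => j _; rewrite linearZ/= l1Z mulrC ler_wpM2l ?l1_ge0//.
exact: normr_entry_le.
Qed.

End matrix_bound.

(** * The inner product and its continuity *)

Section euclidean.
Context {R : realType} {V : vectType R} (dot : {dot V for idfun}).
Implicit Types u v w : V.

Lemma dotC u v : dot u v = dot v u.
Proof. by rewrite (hermC (theta := idfun) dot) expr0 mul1r. Qed.

Lemma dotDl u v w : dot (u + v) w = dot u w + dot v w.
Proof. exact: linearDl. Qed.

Lemma dotBl u v w : dot (u - v) w = dot u w - dot v w.
Proof. exact: linearBl. Qed.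

Lemma dotZl (c : R) u w : dot (c *: u) w = c * dot u w.
Proof. exact: linearZl_LR. Qed.

Lemma dotDr u v w : dot w (u + v) = dot w u + dot w v.
Proof. by rewrite !(dotC w) dotDl. Qed.

Lemma dotBr u v w : dot w (u - v) = dot w u - dot w v.
Proof. by rewrite !(dotC w) dotBl. Qed.

Lemma dotZr (c : R) u w : dot w (c *: u) = c * dot w u.
Proof. by rewrite !(dotC w) dotZl. Qed.

Lemma dot0l w : dot 0 w = 0.
Proof. by rewrite -(scale0r 0) dotZl mul0r. Qed.

Lemma dot0r w : dot w 0 = 0.
Proof. by rewrite dotC dot0l. Qed.

Lemma dot_ge0 u : 0 <= dot u u.
Proof.
have [->|/(neq0_dnorm_gt0 (s := dot))/ltW//] := eqVneq u 0; by rewrite dot0l.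
Qed.

Lemma dot_eq0 u : dot u u = 0 -> u = 0.
Proof.
by move=> uu; apply: contra_eq uu => /(neq0_dnorm_gt0 (s := dot))/lt0r_neq0.
Qed.

Lemma dot_subZ (t : R) u v : dot (u - t *: v) (u - t *: v) =
  dot u u - 2 * t * dot u v + t ^+ 2 * dot v v.
Proof. by rewrite dotBl !dotBr !dotZl !dotZr [dot v u]dotC; ring. Qed.

Lemma dot_bounded : exists2 K : R, 0 < K &
  forall u v, `|dot u v| <= K * l1 u * l1 v.
Proof.
apply: (@bilinear_bounded R V V R^o Num.norm (@ler_normD _ R)) => [c x||].
- exact: normrM.
- by move=> u c x y; rewrite dotDr dotZr.
- by move=> u c x y; rewrite dotDl dotZl.
Qed.

Lemma cvg_dot (U : set_system nat) {UF : UltraFilter U} x y (l m : V) :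
  ulim U x l -> ulim U y m -> dot (x n) (y n) @[n --> U] --> dot l m.
Proof.
move=> xl ym; have [K K0 dK] := dot_bounded.
apply: (@cvg_dist_le _ _ _ _
  (fun n => K * l1 (x n) * l1 (y n - m) + K * l1 (x n - l) * l1 m)).
  apply: nearW => n; apply: le_trans (lerD (dK _ _) (dK _ _)).
  by apply: le_trans (ler_normD _ _); rewrite dotBr dotBl addrA subrK.
have -> : 0 = K * l1 l * 0 + K * 0 * l1 m :> R.
  by rewrite !mulr0 mul0r addr0.
apply: cvgD; first by apply: cvgM => //; apply: cvgMl_tmp; exact: ulim_l1.
by apply: cvgMr_tmp; exact: cvgMl_tmp.
Qed.

End euclidean.

Section endomorphisms.
Context {R : realType} {V : vectType R}.
Implicit Types (X Y : 'End(V)) (v : V).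

Let compl X : linear (fun Y => (X \o Y)%VF).
Proof. by move=> c Y Z; rewrite comp_lfunDr comp_lfunZr. Qed.

Let compr Y : linear (fun X => (X \o Y)%VF).
Proof. by move=> c X Z; rewrite comp_lfunDl comp_lfunZl. Qed.

Let appl X : linear (fun_of_lfun X).
Proof. exact: linearP. Qed.

Let appr v : linear (fun X : 'End(V) => X v).
Proof. by move=> c X Y; rewrite add_lfunE scale_lfunE. Qed.

Lemma comp_bounded : exists2 K : R, 0 < K &
  forall X Y, l1 (X \o Y)%VF <= K * l1 X * l1 Y.
Proof. exact: (bilinear_bounded (@l1D R _) (@l1Z R _) compl compr). Qed.

Lemma app_bounded : exists2 K : R, 0 < K &
  forall X v, l1 (X v) <= K * l1 X * l1 v.
Proof. exact: (bilinear_bounded (@l1D R _) (@l1Z R _) appl appr). Qed.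

Context (U : set_system nat) {UF : UltraFilter U}.

Lemma ulim_comp (x y : nat -> 'End(V)) X Y : ulim U x X -> ulim U y Y ->
  ulim U (fun n => (x n \o y n)%VF) (X \o Y)%VF.
Proof. exact: (ulim_bilinear compl compr). Qed.

Lemma ulim_app (x : nat -> 'End(V)) y X v : ulim U x X -> ulim U y v ->
  ulim U (fun n => x n (y n)) (X v).
Proof. exact: (ulim_bilinear appl appr). Qed.

(** Subspaces are closed, because the projection onto [a] commutes with limits. *)
Lemma memv_ulim (a : {vspace V}) (x : nat -> V) v :
  ulim U x v -> (\forall n \near U, x n \in a) -> v \in a.
Proof.
move=> xv xa; have -> : v = projv a v; last exact: memv_proj.
apply: (ulim_unique xv); apply: near_ulim (ulim_linear (projv a) xv).
by apply: filterS xa => n /projv_id.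
Qed.

End endomorphisms.

(** * The Lie algebra of a compact group *)

Section orthogonal_group.
Context {R : realType} {V : vectType R} (dot : {dot V for idfun}).
Context (G : set 'End(V)).
Hypothesis Gorth : orthogonal_subgroup dot G.
Implicit Types (g h X Y Z : 'End(V)) (u v w x y : V).

Lemma grp_dot g : G g -> forall x y, dot (g x) (g y) = dot x y.
Proof. by case: Gorth => + _ _ _; apply. Qed.

Lemma grp1 : G \1%VF.
Proof. by case: Gorth. Qed.

Lemma grpM g h : G g -> G h -> G (g \o h)%VF.
Proof. by case: Gorth => _ _ + _; apply. Qed.

Lemma grpV g : G g -> G (g^-1)%VF.
Proof. by case: Gorth => _ _ _; apply. Qed.

Lemma grp_lker0 g : G g -> lker g == 0%VS.
Proof.
move=> Gg; rewrite -subv0; apply/subvP => v; rewrite memv_ker memv0 => /eqP gv.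
by apply/eqP/(dot_eq0 (dot := dot)); rewrite -(grp_dot Gg) gv dot0l.
Qed.

Lemma grpVK g v : G g -> (g^-1)%VF (g v) = v.
Proof. by move=> Gg; rewrite lker0_lfunK// grp_lker0. Qed.

Lemma grpKV g v : G g -> g ((g^-1)%VF v) = v.
Proof. by move=> Gg; rewrite lker0_lfunVK// grp_lker0. Qed.

Lemma dotVl g u v : G g -> dot ((g^-1)%VF u) v = dot u (g v).
Proof. by move=> Gg; rewrite -(grp_dot Gg) grpKV. Qed.

Fixpoint lfun_pow g k : 'End(V) :=
  if k is k'.+1 then (lfun_pow g k' \o g)%VF else \1%VF.

Lemma grp_pow g k : G g -> G (lfun_pow g k).
Proof. by move=> Gg; elim: k => [|k IH] /=; [exact: grp1|exact: grpM]. Qed.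

(* X is the velocity at 1 of a curve in G that shares with exp(tX) the two
   properties that are needed: a quadratic error term and the fixed points. *)
Definition lie_alg X : Prop := exists (gam : R -> 'End(V)) (C : R),
  [/\ forall t, G (gam t),
      forall t, `|t| <= 1 -> l1 (gam t - \1 - t *: X)%VF <= C * t ^+ 2 &
      forall t v, X v = 0 -> gam t v = v].

Definition commuting (b : {vspace V}) : Prop :=
  forall x y X, x \in b -> y \in b -> lie_alg X -> dot (X x) y = 0.

(** Conjugate the curve. Differentiating this invariance later takes the place of the Lie
    bracket. *)
Lemma lie_algJ g X : G g -> lie_alg X -> lie_alg (g^-1 \o X \o g)%VF.
Proof.
move=> Gg [gam [C [Ggam gamC gamX]]].
have [K K0 cK] := comp_bounded (V := V).
exists (fun t => (g^-1 \o gam t \o g)%VF).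
exists (K * (K * l1 (g^-1)%VF * C) * l1 g); split=> [t|t t1|t v].
- by apply: grpM => //; apply: grpM => //; exact: grpV.
- have -> : (g^-1 \o gam t \o g - \1 - t *: (g^-1 \o X \o g) =
     g^-1 \o (gam t - \1 - t *: X) \o g)%VF.
    apply/lfunP => v; rewrite !(comp_lfunE, add_lfunE, opp_lfunE, scale_lfunE).
    by rewrite !linearB/= !id_lfunE grpVK// [(g^-1)%VF (t *: _)]linearZ.
  apply: le_trans (cK _ _) _.
  rewrite -!mulrA ler_pM2l//.
  rewrite [leRHS](_ : _ = (K * l1 (g^-1)%VF * (C * t ^+ 2)) * l1 g); last ring.
  rewrite ler_wpM2r ?l1_ge0//; apply: le_trans (cK _ _) _.
  by rewrite ler_wpM2l ?gamC// mulr_ge0 ?l1_ge0// ltW.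
- rewrite !comp_lfunE => /(congr1 g); rewrite grpKV// linear0 => /gamX ->.
  by rewrite grpVK.
Qed.

Hypothesis Gcompact : compact_endomorphisms G.

Section limits.
Context (U : set_system nat) {UF : UltraFilter U}.

Lemma grp_ulim (g : nat -> 'End(V)) : (\forall n \near U, G (g n)) ->
  exists2 h, G h & ulim U g h.
Proof.
move=> Gg; have [||_ [h Gh <-] gh] :=
  @ultra_compact U UF 'M[R]_(\dim {:V}) [set coords_end g | g in G]
    (fun n => coords_end (g n)).
- exact: Gcompact.
- by apply: filterS Gg => n Gn; exists (g n).
exists h => //.
have [K hK] := matrix_bounded (hommx (vbasis {:V}) (vbasis {:V})).
apply: (@ulim_le _ _ _ _ _ _ (fun n => K * `|coords_end (g n) - coords_end h|)).
  apply: nearW => n; apply: le_trans (hK _).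
  by rewrite linearB/= !(mxofK (vbasisP _) (vbasisP _)).
rewrite -(mulr0 K); apply: cvgMl_tmp; apply/norm_cvg0P.
rewrite -(subrr (coords_end h)); apply: cvgB; [exact: gh|exact: cvg_cst].
Qed.

End limits.

Lemma ultra_infty : exists U : set_system nat, UltraFilter U /\ \oo `<=` U.
Proof. exact: ultraFilterLemma. Qed.

Lemma grp_bounded : exists2 M : R, 0 < M & forall g, G g -> l1 g <= M.
Proof.
have [U [UF Uoo]] := ultra_infty.
apply: contrapT => nb.
have /choice[g gP] (n : nat) : exists g, G g /\ n.+1%:R < l1 g.
  apply: contrapT => nbn; apply: nb; exists n.+1%:R => // g Gg.
  by rewrite leNgt; apply/negP => gn; apply: nbn; exists g.
have [|h Gh gh] := @grp_ulim U UF g.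
  by apply: nearW => n; have [] := gP n.
have : U [set n | l1 h + 1 <= n.+1%:R].
  apply: Uoo; exists (Num.truncn (l1 h + 1)) => // n /= hn.
  apply/ltW/(lt_le_trans (truncnS_gt _)).
  by rewrite ler_nat ltnS.
move=> /(filterI (ulim_bounded gh)) /filter_ex[n /= [h1 h2]].
by have [_] := gP n; lra.
Qed.

Lemma grp_act_bounded : exists2 M : R, 0 < M &
  (forall g v, G g -> l1 (g v) <= M * l1 v) /\
  (forall g X, G g -> l1 (g \o X)%VF <= M * l1 X).
Proof.
have [M M0 gM] := grp_bounded.
have [K K0 cK] := comp_bounded (V := V); have [L L0 aL] := app_bounded (V := V).
exists (L * M + K * M); first by rewrite addr_gt0// mulr_gt0.
split=> [g v Gg|g X Gg].
  apply: le_trans (aL _ _) _; rewrite ler_wpM2r ?l1_ge0//.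
  by rewrite ler_wpDr ?ler_wpM2l ?gM// ?mulr_ge0 ?ltW.
apply: le_trans (cK _ _) _; rewrite ler_wpM2r ?l1_ge0//.
by rewrite ler_wpDl ?ler_wpM2l ?gM// ?mulr_ge0 ?ltW.
Qed.

(** Both bounds follow by telescoping, as all powers of g stay in the bounded set G. The first sums
    g^(k+1) v - v = g^k (g v - v) + (g^k v - v). The second sums the products (g^k - 1)(g - 1), each
    at most a multiple of k |g - 1|^2. This controls g^k as an approximation of an exponential. *)
Lemma pow_estimate : exists2 M : R, 0 < M &
  (forall g k v, G g -> l1 (lfun_pow g k v - v) <= k%:R * M * l1 (g v - v)) /\
  (forall g k, G g -> l1 (lfun_pow g k - \1 - k%:R *: (g - \1))%VF <=
     M * (k%:R * l1 (g - \1)%VF) ^+ 2).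
Proof.
have [M M0 [gM cM]] := grp_act_bounded.
have [K K0 cK] := comp_bounded (V := V).
have KM0 : 0 <= K * M by rewrite mulr_ge0// ltW.
have P1 g k v : G g -> l1 (lfun_pow g k v - v) <= k%:R * M * l1 (g v - v).
  move=> Gg; elim: k => [|k IH] /=.
    by rewrite id_lfunE subrr l1_0 !mul0r.
  rewrite comp_lfunE; have -> : lfun_pow g k (g v) - v =
    lfun_pow g k (g v - v) + (lfun_pow g k v - v).
    by rewrite linearB/= addrA subrK.
  apply: le_trans (l1D _ _) _; rewrite -natr1 !mulrDl mul1r addrC lerD//.
  by apply: gM; exact: grp_pow.
have P2 g k : G g -> l1 (lfun_pow g k - \1)%VF <= k%:R * M * l1 (g - \1)%VF.
  move=> Gg; elim: k => [|k IH] /=.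
    by rewrite subrr l1_0 !mul0r.
  have -> : (lfun_pow g k \o g - \1 =
    lfun_pow g k \o (g - \1) + (lfun_pow g k - \1))%VF.
    by rewrite comp_lfunDr comp_lfunNr comp_lfun1r addrA subrK.
  apply: le_trans (l1D _ _) _; rewrite -natr1 !mulrDl mul1r addrC lerD//.
  by apply: cM; exact: grp_pow.
exists (M + K * M); first by rewrite ltr_wpDr.
split=> [g k v Gg|g k Gg].
  apply: le_trans (P1 _ _ _ Gg) _; rewrite ler_wpM2r ?l1_ge0// ler_wpM2l//.
  by rewrite ler_wpDr.
apply: le_trans (_ : K * M * (k%:R * l1 (g - \1)%VF) ^+ 2 <= _); last first.
  by rewrite ler_wpM2r ?sqr_ge0// ler_wpDl// ltW.
elim: k => [|k IH] /=.
  by rewrite subrr scale0r subr0 l1_0 mul0r expr0n mulr0.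
have -> : (lfun_pow g k \o g - \1 - k.+1%:R *: (g - \1) =
  (lfun_pow g k - \1) \o (g - \1) + (lfun_pow g k - \1 - k%:R *: (g - \1)))%VF.
  apply/lfunP => v.
  rewrite !(comp_lfunE, add_lfunE, opp_lfunE, scale_lfunE, id_lfunE).
  rewrite [lfun_pow g k (_ - _)]linearB/= -natr1 scalerDl scale1r.
  set a := lfun_pow g k (g v); set b := lfun_pow g k v; set c := k%:R *: _.
  by rewrite addrACA subrKA -opprD [_ - v + c]addrC.
apply: le_trans (l1D _ _) _; apply: le_trans (lerD (cK _ _) IH) _.
have := P2 g k Gg; have := l1_ge0 (g - \1)%VF.
set s := l1 (g - _)%VF; set q := l1 (lfun_pow g k - _)%VF => s0 qs.
(* Split (k + 1)^2 as k + k^2 + (k + 1): the first term pays for the product, the second for the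
   induction hypothesis, the third is slack. *)
rewrite [leRHS](_ : _ = K * (k%:R * M * s) * s + K * M * (k%:R * s) ^+ 2 +
  K * M * (k%:R + 1) * s ^+ 2); last by rewrite -natr1; ring.
rewrite -[leLHS]addr0 lerD ?lerD//.
  by rewrite ler_wpM2r// ler_wpM2l// ltW.
by rewrite mulr_ge0 ?sqr_ge0// mulr_ge0// addr_ge0.
Qed.

End orthogonal_group.

(** * Limits of difference quotients belong to the Lie algebra *)

Section lie_algebra.
Context {R : realType} {V : vectType R} {dot : {dot V for idfun}}.
Context {G : set 'End(V)}.
Hypothesis Gorth : orthogonal_subgroup dot G.
Hypothesis Gcompact : compact_endomorphisms G.
Implicit Types (g h X Y Z : 'End(V)) (u v w x y : V).

Section difference_quotients.
Context (U : set_system nat) {UF : UltraFilter U}.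
Context (g : nat -> 'End(V)) (r : nat -> R) (X : 'End(V)).
Hypothesis Gg : \forall n \near U, G (g n).
Hypothesis r_gt0 : \forall n \near U, 0 < r n.
Hypothesis r0 : r n @[n --> U] --> (0 : R).
Hypothesis gX : ulim U (fun n => (r n)^-1 *: (g n - \1)%VF) X.

(* The point at time t is the limit of g_n^k with k the integer part of
   t / r_n. *)
Lemma one_sided_curve : exists2 C : R, 0 <= C & forall t : R, 0 <= t ->
  exists h, [/\ G h, l1 (h - \1 - t *: X)%VF <= C * t ^+ 2 &
                forall v, X v = 0 -> h v = v].
Proof.
have [M M0 [pv pE]] := pow_estimate Gorth Gcompact.
exists (M * l1 X ^+ 2); first by rewrite mulr_ge0 ?sqr_ge0// ltW.
move=> t t0; pose k n := Num.truncn (t / r n).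
have krt : (k n)%:R * r n @[n --> U] --> t.
  apply: cvg_dist_le r0; apply: filterS r_gt0 => n rn.
  have q0 : 0 <= t / r n by rewrite divr_ge0// ltW.
  have /andP[k1 k2] := truncn_itv q0; rewrite -/(k n) in k1 k2.
  rewrite ler_pdivlMr// in k1; rewrite ltr_pdivrMr// -natr1 mulrDl mul1r in k2.
  have k3 : 0 <= t - (k n)%:R * r n by rewrite subr_ge0.
  by rewrite distrC (ger0_norm k3); lra.
have [|h Gh hh] := @grp_ulim _ _ _ Gcompact U _ (fun n => lfun_pow (g n) (k n)).
  by apply: filterS Gg => n; exact: (grp_pow Gorth).
have scaled n : 0 < r n -> (k n)%:R *: (g n - \1)%VF =
    ((k n)%:R * r n) *: ((r n)^-1 *: (g n - \1)%VF).
  by move=> rn; rewrite scalerA mulfK// gt_eqF.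
exists h; split=> // [|v Xv].
  have lhs : l1 (lfun_pow (g n) (k n) - \1 - (k n)%:R *: (g n - \1))%VF
      @[n --> U] --> l1 (h - \1 - t *: X)%VF.
    apply: ulim_l1; apply: ulimB; first by apply: ulimB => //; exact: ulim_cst.
    apply: (near_ulim _ (ulimZ krt gX)).
    by apply: filterS r_gt0 => n /scaled ->.
  have rhs : M * (((k n)%:R * r n) * l1 ((r n)^-1 *: (g n - \1)%VF)) ^+ 2
      @[n --> U] --> M * (t * l1 X) ^+ 2.
    by apply: cvgMl_tmp; apply: cvgM; apply: cvgM => //; exact: ulim_l1.
  rewrite -mulrA -exprMn [l1 X * t]mulrC.
  apply: ler_cvg_to lhs rhs _.
  apply: filterS2 Gg r_gt0 => n Gn rn; apply: le_trans (pE _ _ Gn) _.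
  rewrite l1Z gtr0_norm ?invr_gt0// [(k n)%:R * r n * _]mulrA mulfK//.
  by rewrite gt_eqF.
(* The linear bound of [pow_estimate], applied to v, becomes |h v - v| <= M t |X v| in the limit, so
   zeros of X are fixed by h. *)
have lhs : l1 (lfun_pow (g n) (k n) v - v) @[n --> U] --> l1 (h v - v).
  apply: ulim_l1; apply: ulimB; last exact: ulim_cst.
  by apply: ulim_app => //; exact: ulim_cst.
have rhs : M * (((k n)%:R * r n) * l1 (((r n)^-1 *: (g n - \1)%VF) v))
    @[n --> U] --> M * (t * l1 (X v)).
  apply: cvgMl_tmp; apply: cvgM => //; apply: ulim_l1.
  by apply: ulim_app => //; exact: ulim_cst.
apply/eqP; rewrite -subr_eq0; apply/eqP/l1_eq0/eqP; rewrite eq_le l1_ge0 andbT.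
suff : l1 (h v - v) <= M * (t * l1 (X v)) by rewrite Xv l1_0 !mulr0.
apply: ler_cvg_to lhs rhs _.
apply: filterS2 Gg r_gt0 => n Gn rn; apply: le_trans (pv _ _ _ Gn) _.
rewrite scale_lfunE add_lfunE opp_lfunE id_lfunE l1Z gtr0_norm ?invr_gt0//.
by rewrite [(k n)%:R * r n * _]mulrA mulfK ?gt_eqF// mulrA [M * _]mulrC.
Qed.

(** [one_sided_curve] gives the points at times t >= 0. At t = - s < 0 take the inverse of the point
    h at s: h^-1 - 1 - t X equals h^-1 applied to - (h - 1 - s X) + s (h - 1) X, and both terms are
    quadratic in s since h - 1 is of order s for s <= 1. *)
Lemma lie_alg_quotient : lie_alg G X.
Proof.
have [C C0 hC] := one_sided_curve.
have [M M0 [_ cM]] := grp_act_bounded Gcompact.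
have [K K0 cK] := comp_bounded (V := V).
pose D := C + M * (C + K * (C + l1 X) * l1 X).
have CX0 : 0 <= C + l1 X by rewrite addr_ge0 ?l1_ge0.
have KX0 : 0 <= K * (C + l1 X) * l1 X by rewrite !mulr_ge0 ?l1_ge0// ltW.
have /choice[gam gamP] (t : R) : exists h, [/\ G h,
    `|t| <= 1 -> l1 (h - \1 - t *: X)%VF <= D * t ^+ 2 &
    forall v, X v = 0 -> h v = v].
  have [t0|t0] := leP 0 t.
    have [h [Gh hX hv]] := hC _ t0; exists h; split=> // _.
    apply: le_trans hX _.
    rewrite ler_wpM2r ?sqr_ge0// lerDl mulr_ge0 ?(ltW M0)//.
    by rewrite addr_ge0.
  pose s := - t; have s0 : 0 <= s by rewrite oppr_ge0 ltW.
  have [h [Gh hX hv]] := hC _ s0.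
  exists (h^-1)%VF; split=> [|t1|v Xv]; first exact: (grpV Gorth).
    have s1 : s <= 1 by rewrite ltr0_norm in t1.
    have -> : ((h^-1)%VF - \1 - t *: X =
      (h^-1)%VF \o (- (h - \1 - s *: X) + s *: ((h - \1) \o X)))%VF.
      apply/lfunP => v.
      rewrite !(comp_lfunE, add_lfunE, opp_lfunE, scale_lfunE, id_lfunE).
      rewrite -[t]opprK -/s scaleNr opprK.
      have -> : - (h v - v - s *: X v) + s *: (h (X v) - X v) =
          v - h v + s *: h (X v).
        rewrite scalerBr !opprB [s *: X v + _]addrC -addrA.
        by rewrite [s *: X v + _]addrC subrK.
      rewrite linearD/= linearB/= (grpVK Gorth)// [(h^-1)%VF (s *: _)]linearZ/=.
      by rewrite (grpVK Gorth).
    apply: le_trans (cM _ _ (grpV Gorth Gh)) _.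
    rewrite /D mulrDl -mulrA -[leLHS]add0r lerD ?(mulr_ge0 C0 (sqr_ge0 _))//.
        rewrite ler_wpM2l ?(ltW M0)//; apply: le_trans (l1D _ _) _.
    rewrite l1N -[t]opprK -/s sqrrN mulrDl lerD// l1Z ger0_norm//.
    have h1 : l1 (h - \1)%VF <= s * (C + l1 X).
      have -> : (h - \1 = (h - \1 - s *: X) + s *: X)%VF by rewrite subrK.
      apply: le_trans (l1D _ _) _; rewrite l1Z ger0_norm// mulrDr lerD//.
      apply: le_trans hX _; rewrite mulrC ler_wpM2r//.
      by rewrite expr2 -[leRHS]mul1r ler_wpM2r.
    rewrite [leRHS](_ : _ = s * (K * (s * (C + l1 X)) * l1 X)); last by ring.
    rewrite ler_wpM2l//; apply: le_trans (cK _ _) _.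
    by rewrite ler_wpM2r ?l1_ge0// ler_wpM2l// ltW.
  by rewrite -{1}(hv v Xv) (grpVK Gorth).
exists gam, D; split=> [t|t t1|t v]; have [h1 h2 h3] := gamP t => //.
- exact: h2.
- exact: h3.
Qed.

End difference_quotients.

End lie_algebra.

Lemma is_derive_quadratic {R : realType} {W : normedModType R} (f : R -> W)
    (df : W) (C : R) :
  (forall t, `|t| <= 1 -> `|f t - f 0 - t *: df| <= C * t ^+ 2) ->
  is_derive (0 : R) (1 : R) f df.
Proof.
move=> fC; have C0 : 0 <= C.
  have := fC 1; rewrite normr1 expr1n mulr1 => /(_ (lexx _)).
  exact: le_trans.
have q : h^-1 *: ((f \o shift 0) (h *: (1 : R)) - f 0)
    @[h --> (0 : R)^'] --> df.
  apply/cvgrPdist_le => /= e e0; near=> h.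
  have h0 : h != 0 by near: h; exact: nbhs_dnbhs_neq.
  (* The 1 brings h into the range of the hypothesis; C + 1 replaces C because C may be 0. *)
  have h1 : `|h| <= Num.min 1 (e / (C + 1)).
    near: h; apply: dnbhs0_le; rewrite lt_min ltr01 divr_gt0//.
    by rewrite ltr_wpDl.
  move: h1; rewrite le_min => /andP[h1 he].
  rewrite /= addr0 [h *: 1]mulr1 -[df](scalerK h0) -scalerBr normrZ normfV.
  rewrite distrC ler_pdivrMl ?normr_gt0//.
  apply: le_trans (fC _ h1) _; rewrite -real_normK ?num_real// expr2 mulrA.
  rewrite mulrC ler_wpM2l//; apply: le_trans (ler_wpM2l C0 he) _.
  by rewrite mulrA ler_pdivrMr ?ltr_wpDl// mulrC ler_wpM2l ?(ltW e0)// lerDl.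
by split; [exact: cvgP q|exact: cvg_lim q].
Unshelve. all: by end_near. Qed.

Lemma filter_cvg_le {T : topologicalType} (F E : set_system nat) (x : nat -> T)
    (l : T) :
  F `<=` E -> x n @[n --> F] --> l -> x n @[n --> E] --> l.
Proof. by move=> FE xl A /xl; exact: FE. Qed.

Lemma cvg_eq0 {R : realType} (U : set_system nat) {UF : UltraFilter U}
    (x : nat -> R) (l : R) :
  x n @[n --> U] --> l -> (\forall n \near U, x n = 0) -> l = 0.
Proof.
move=> xl x0; apply/eqP; rewrite eq_le.
rewrite (cvgr_to_le xl) ?(cvgr_to_ge xl)//.
  by apply: filterS x0 => n ->.
by apply: filterS x0 => n ->.
Qed.

(** * Infinitesimal consequences of orthogonality and of condition (B) *)

Section lie_algebra_theory.
Context {R : realType} {V : vectType R} {dot : {dot V for idfun}}.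
Context {G : set 'End(V)}.
Hypothesis Gorth : orthogonal_subgroup dot G.
Hypothesis Gcompact : compact_endomorphisms G.
Implicit Types (g h X Y Z : 'End(V)) (u v w x y : V) (a b : {vspace V}).

Lemma lie_algN X : lie_alg G X -> lie_alg G (- X).
Proof.
move=> [gam [C [Ggam gamC gamX]]]; exists (fun t => gam (- t)), C.
split=> [t|t t1|t v]; first exact: Ggam.
  by rewrite scalerN -scaleNr -sqrrN; apply: gamC; rewrite normrN.
by rewrite opp_lfunE => /eqP; rewrite oppr_eq0 => /eqP; exact: gamX.
Qed.

(** The curve of X, applied to u, runs in the orbit. This is the only access to tangent spaces, and
    it turns (B) into a statement about the Lie algebra. *)
Lemma tangent_lie_alg X u : lie_alg G X -> tangent_space (orbit_of G u) u (X u).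
Proof.
move=> [gam [C [Ggam gamC gamX]]].
have [K K0 aK] := app_bounded (V := V).
have gam0 : gam 0 = \1%VF.
  (* At t = 0 the quadratic error vanishes, so the curve starts at 1. *)
  apply/eqP; rewrite -subr_eq0; apply/eqP/l1_eq0/eqP.
  rewrite eq_le l1_ge0 andbT.
  have := gamC 0; rewrite normr0 scale0r subr0 expr0n mulr0; exact.
exists (fun t => gam t u); split.
- by rewrite gam0 id_lfunE.
- by apply: (@filterE _ _ (@nbhs_filter R 0)) => t; exists (gam t).
apply: (@is_derive_quadratic _ _ _ _ (K * C * l1 u)) => t t1.
have -> : coords (gam t u) - coords (gam 0 u) - t *: coords (X u) =
    coords ((gam t - \1 - t *: X)%VF u).
  rewrite gam0 !(add_lfunE, opp_lfunE, scale_lfunE, id_lfunE) /coords.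
  by rewrite -linearZ -!linearB.
apply: le_trans (normr_coords _) _; apply: le_trans (aK _ _) _.
rewrite [leRHS]mulrAC ler_wpM2r ?l1_ge0// -mulrA ler_wpM2l ?(ltW K0)//.
exact: gamC.
Qed.

Lemma cartan_commuting a : cartan_subspace dot G a -> commuting dot G a.
Proof.
move=> [_ aB] x y X xa ya /(tangent_lie_alg x) tX.
exact: aB tX _ ya.
Qed.

Section sequences.
Context {U : set_system nat} {UF : UltraFilter U} (Uoo : \oo `<=` U).

Definition small n : R := n.+1%:R^-1.

Lemma small_gt0 n : 0 < small n. Proof. by rewrite invr_gt0. Qed.

Lemma small_cvg : small n @[n --> U] --> (0 : R).
Proof. exact: filter_cvg_le Uoo (@cvg_harmonic R). Qed.

(** Sampling the curve at the times [small n] lets derivatives be computed as limits along [U]. *)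
Lemma lie_alg_seq X : lie_alg G X -> exists2 g : nat -> 'End(V),
  forall n, G (g n) & ulim U (fun n => (small n)^-1 *: (g n - \1)%VF) X.
Proof.
move=> [gam [C [Ggam gamC gamX]]].
exists (fun n => gam (small n)) => //.
apply: (@ulim_le _ _ _ _ _ _ (fun n => C * small n)); last first.
  by rewrite -(mulr0 C); apply: cvgMl_tmp; exact: small_cvg.
apply: nearW => n; have s0 := small_gt0 n.
have s1 : `|small n| <= 1 by rewrite gtr0_norm// invf_le1// ler1n.
rewrite -[X in l1 (_ - X)](scalerK (lt0r_neq0 s0)) -scalerBr l1Z.
rewrite gtr0_norm ?invr_gt0// ler_pdivrMl// mulrCA -expr2.
exact: gamC.
Qed.

End sequences.

(** Differentiate <g x, g y> = <x, y> at g = 1. With g = 1 + s D, the sum <D x, y> + <x, D y> + s <D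
    x, D y> is exactly 0 before the limit is taken. *)
Lemma lie_alg_skew X x y : lie_alg G X -> dot (X x) y = - dot x (X y).
Proof.
have [U [UF Uoo]] := ultra_infty.
move=> /(lie_alg_seq Uoo)[g Gg gX].
apply/eqP; rewrite -subr_eq0 opprK; apply/eqP.
pose D n := (small n)^-1 *: (g n - \1)%VF : 'End(V).
have Dv v : ulim U (fun n => D n v) (X v).
  by apply: ulim_app => //; exact: ulim_cst.
have : dot (D n x) y + dot x (D n y) + small n * dot (D n x) (D n y)
    @[n --> U] --> dot (X x) y + dot x (X y) + 0 * dot (X x) (X y).
  apply: cvgD; last by apply: cvgM; [exact: small_cvg|exact: cvg_dot].
  by apply: cvgD; apply: cvg_dot => //; exact: ulim_cst.
rewrite mul0r addr0 => /cvg_eq0; apply; apply: nearW => n.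
have gE v : g n v = v + small n *: D n v.
  rewrite /D scale_lfunE scalerKV ?lt0r_neq0 ?small_gt0//.
  by rewrite add_lfunE opp_lfunE id_lfunE addrC subrK.
have := grp_dot Gorth (Gg n) x y.
rewrite !gE dotDl !dotDr !dotZl !dotZr => h.
have s0 := lt0r_neq0 (small_gt0 n).
apply: (mulfI s0); rewrite mulr0.
by lra.
Qed.

(** Since g^-1 Z g is in the Lie algebra, <Z g x, g y> = 0 for all g in G. Its derivative at 1 in
    the direction X is <Z X x, y> + <Z x, X y> = 0, and skewness of Z turns this into the claim. *)
Lemma commuting_sym b X Z x y : commuting dot G b -> x \in b -> y \in b ->
  lie_alg G X -> lie_alg G Z -> dot (X y) (Z x) = dot (Z y) (X x).
Proof.
have [U [UF Uoo]] := ultra_infty.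
move=> cb xb yb lX lZ; have [g Gg gX] := lie_alg_seq Uoo lX.
apply/eqP; rewrite -subr_eq0; apply/eqP.
pose D n := (small n)^-1 *: (g n - \1)%VF : 'End(V).
have Dv v : ulim U (fun n => D n v) (X v).
  by apply: ulim_app => //; exact: ulim_cst.
have ZDv v : ulim U (fun n => Z (D n v)) (Z (X v)) by exact: ulim_linear.
have : dot (D n y) (Z x) + dot y (Z (D n x)) +
      small n * dot (D n y) (Z (D n x))
    @[n --> U] --> dot (X y) (Z x) + dot y (Z (X x)) + 0 * dot (X y) (Z (X x)).
  apply: cvgD; last by apply: cvgM; [exact: small_cvg|exact: cvg_dot].
  by apply: cvgD; apply: cvg_dot => //; exact: ulim_cst.
rewrite mul0r addr0 -[dot y _]opprK -(lie_alg_skew _ _ lZ).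
move=> /cvg_eq0; apply; apply: nearW => n.
have gE v : g n v = v + small n *: D n v.
  rewrite /D scale_lfunE scalerKV ?lt0r_neq0 ?small_gt0//.
  by rewrite add_lfunE opp_lfunE id_lfunE addrC subrK.
have := cb _ _ _ xb yb (lie_algJ Gorth (Gg n) lZ).
rewrite !comp_lfunE (dotVl Gorth)// dotC !gE linearD/= linearZ/=.
rewrite dotDl !dotDr !dotZl !dotZr [dot y (Z x)]dotC cb// => h.
have s0 := lt0r_neq0 (small_gt0 n).
apply: (mulfI s0); rewrite mulr0.
by lra.
Qed.

End lie_algebra_theory.

(** * Regular points of commuting subspaces *)

Section horner_vectors.
Context {R : realType} {V : vectType R}.

(** The polynomial in [t] with coefficients [s], in Horner form. With x followed by a basis of b as
    coefficients, it is a curve in b that tends to x as t tends to 0 and whose points span b. *)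
Fixpoint vhorner (t : R) (s : seq V) : V :=
  if s is v :: s' then v + t *: vhorner t s' else 0.

Lemma vhorner_linear (f : 'End(V)) t s :
  f (vhorner t s) = vhorner t [seq f v | v <- s].
Proof.
by elim: s => [|v s IH] /=; rewrite ?linear0// linearD/= linearZ/= IH.
Qed.

Lemma memv_vhorner (b : {vspace V}) t s :
  {subset s <= b} -> vhorner t s \in b.
Proof.
elim: s => [|v s IH] /= sb; first exact: mem0v.
apply: memvD; first exact/sb/mem_head.
apply/memvZ/IH => u us.
by rewrite sb// in_cons us orbT.
Qed.

Context (U : set_system nat) {UF : UltraFilter U} (Uoo : \oo `<=` U).

Lemma vhorner_cvg v s : ulim U (fun n => vhorner (small n) (v :: s)) v.
Proof.
elim: s v => [|u s IH] v /=.
  by under eq_fun do rewrite scaler0 addr0; exact: ulim_cst.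
rewrite -[X in ulim _ _ X]addr0; apply: ulimD; first exact: ulim_cst.
by rewrite -(scale0r u); apply: ulimZ; [exact: small_cvg|exact: IH].
Qed.

(** The constant coefficient is the limit, hence 0; divide by t > 0 and repeat. *)
Lemma vhorner_eq0 s : (\forall n \near U, vhorner (small n) s = 0) ->
  {in s, forall v, v = 0}.
Proof.
elim: s => // u s IH us0.
have u0 : u = 0.
  apply: ulim_unique (vhorner_cvg u s) _.
  by apply: (near_ulim _ (ulim_cst 0)); apply: filterS us0 => n ->.
have : \forall n \near U, vhorner (small n) s = 0.
  apply: filterS us0 => n /=; rewrite u0 add0r => /eqP.
  by rewrite scaler_eq0 gt_eqF ?small_gt0//= => /eqP.
by move=> /IH s0 v; rewrite in_cons => /predU1P[->//|/s0].
Qed.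

Lemma vhorner_subspace (f : 'End(V)) (a b : {vspace V}) v :
  (\forall n \near U, f (vhorner (small n) (v :: vbasis b)) \in a) ->
  (f @: b <= a)%VS.
Proof.
move=> fa; rewrite -(span_basis (vbasisP b)) limg_span; apply/span_subvP => u.
move=> /mapP[c cb ->{u}].
(* Membership in a becomes the vanishing of p, so that the coefficients can be compared. *)
pose p := ((\1 - projv a) \o f)%VF.
suff /eqP : p c = 0.
  rewrite /p comp_lfunE add_lfunE opp_lfunE id_lfunE subr_eq0 => /eqP ->.
  exact: memv_proj.
apply: (vhorner_eq0 (s := [seq p u | u <- v :: vbasis b])); last first.
  by apply: map_f; rewrite in_cons cb orbT.
apply: filterS fa => n fna; rewrite -vhorner_linear.
by rewrite comp_lfunE add_lfunE opp_lfunE id_lfunE projv_id// subrr.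
Qed.

End horner_vectors.

(** * Linear independence is an open condition *)

Section independence.
Context {R : realType} {V : vectType R}.

Definition indep n (f : 'I_n -> V) : Prop :=
  forall k : 'I_n -> R, \sum_i k i *: f i = 0 -> forall i, k i = 0.

Lemma indep_leq_dim n (f : 'I_n -> V) : indep f -> (n <= \dim {:V})%N.
Proof.
move=> fi; have : free [tuple f i | i < n].
  apply/freeP => k k0; apply: fi; rewrite -[RHS]k0.
  by apply: eq_bigr => i _; rewrite -tnth_nth tnth_mktuple.
by rewrite /free size_tuple => /eqP <-; rewrite dimvS// subvf.
Qed.

Context (U : set_system nat) {UF : UltraFilter U}.

Lemma ulim_sum n (F : 'I_n -> nat -> V) (l : 'I_n -> V) :
  (forall i, ulim U (F i) (l i)) ->
  ulim U (fun k => \sum_i F i k) (\sum_i l i).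
Proof.
elim: n F l => [|n IH] F l Fl.
  rewrite big_ord0; under eq_fun do rewrite big_ord0; exact: ulim_cst.
rewrite big_ord_recr/=; under eq_fun do rewrite big_ord_recr/=.
by apply: ulimD; [exact: IH|exact: Fl].
Qed.

(** Otherwise there are relations among the f_k whose coefficients have absolute values summing to
    1. They converge along [U] to a relation among the g with the same normalization, which is thus
    not trivial. *)
Lemma near_indep n (f : nat -> 'I_n -> V) (g : 'I_n -> V) :
  (forall i, ulim U (f^~ i) (g i)) -> indep g -> \forall k \near U, indep (f k).
Proof.
move=> fg gi; have [//|nf] := in_ultra_setVsetC [set k | indep (f k)] UF.
have /choice[c cP] (k : nat) : exists c : 'I_n -> R, ~ indep (f k) ->
    \sum_i c i *: f k i = 0 /\ \sum_i `|c i| = 1.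
  have [fk|] := pselect (indep (f k)); first by exists (fun=> 0).
  move=> /existsNP[c /not_implyP[c0 /existsNP[i ci]]].
  have s0 : 0 < \sum_i `|c i|.
    rewrite (bigD1 i)//= ltr_pwDl ?normr_gt0 ?sumr_ge0//; exact/eqP.
  exists (fun i => (\sum_i `|c i|)^-1 * c i) => _; split.
    under eq_bigr do rewrite -scalerA; by rewrite -scaler_sumr c0 scaler0.
  under eq_bigr do rewrite normrM gtr0_norm ?invr_gt0//.
  by rewrite -mulr_sumr mulVf// gt_eqF.
have /choice[l cl] (i : 'I_n) : exists l : R, c k i @[k --> U] --> l.
  apply: (@ultra_bounded_cvg _ _ _ _ 1); apply: filterS nf => k nk.
  have [_ <-] := cP k nk.
  by rewrite (bigD1 i)//= lerDl sumr_ge0.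
have l0 : \sum_i l i *: g i = 0.
  apply: ulim_unique (_ : ulim U (fun k => \sum_i c k i *: f k i) _) _.
    by apply: ulim_sum => i; apply: ulimZ => //; exact: cl.
  by apply: (near_ulim _ (ulim_cst 0)); apply: filterS nf => k /cP[-> _].
have : \sum_i `|c k i| @[k --> U] --> \sum_i `|l i|.
  by apply: cvg_sumr => i; apply: cvg_norm; exact: cl.
rewrite big1 => [|i _]; last by rewrite (gi l l0) normr0.
move=> c0; suff : (1 : R) <= 0 by rewrite ler10.
by apply: (cvgr_to_ge c0); apply: filterS nf => k /cP[_ ->].
Qed.

End independence.

(** * Existence of regular points and rigidity of limits at them *)

Section regular_points.
Context {R : realType} {V : vectType R} {dot : {dot V for idfun}}.
Context {G : set 'End(V)}.
Hypothesis Gorth : orthogonal_subgroup dot G.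
Hypothesis Gcompact : compact_endomorphisms G.
Implicit Types (g h X Y Z : 'End(V)) (u v w x y : V) (a b : {vspace V}).

Definition regular b x : Prop :=
  forall X, lie_alg G X -> X x = 0 -> forall c, c \in b -> X c = 0.

(* Any x at which X_1 x, ..., X_r x are independent for the largest possible r
   is regular: if X x = 0, then X c is orthogonal to all X_i x by symmetry
   (commuting_sym), so X c <> 0 would give r + 1 independent vectors at
   x + t c for small t. *)
Lemma regular_dense b w (eps : R) : commuting dot G b -> w \in b -> 0 < eps ->
  exists x, [/\ x \in b, l1 (x - w) < eps & regular b x].
Proof.
move=> cb wb eps0; have [U [UF Uoo]] := ultra_infty.
pose P r := exists x (s : 'I_r -> 'End(V)), [/\ x \in b, l1 (x - w) < eps,
  forall i, lie_alg G (s i) & indep (fun i => s i x)].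
have P0 : exists r, `[< P r >].
  exists 0%N; apply/asboolP; exists w, (fun=> 0); split=> //.
  - by rewrite subrr l1_0.
  - by case.
  - by move=> k _; case.
have Pdim r : `[< P r >] -> (r <= \dim {:V})%N.
  by move=> /asboolP[x [s [_ _ _]]]; exact: indep_leq_dim.
case: (ex_maxnP P0 Pdim) => r /asboolP[x [s [xb xw ls sx]]] rmax.
exists x; split=> // X lX Xx c cb'; apply: contrapT => Xc.
pose f n i := if unlift ord0 i is Some j then s j (x + small n *: c) else X c.
pose f0 i := if unlift ord0 i is Some j then s j x else X c.
have : \forall n \near U, indep (f n : 'I_r.+1 -> V).
  apply: (@near_indep _ _ _ _ _ _ f0).
    move=> i; rewrite /f /f0; case: unliftP => [j _|_]; last exact: ulim_cst.
    apply: ulim_linear; rewrite -[X in ulim _ _ X]addr0; apply: ulimD.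
      exact: ulim_cst.
    by rewrite -(scale0r c); apply: ulimZ; [exact: small_cvg|exact: ulim_cst].
  have f00 : f0 ord0 = X c by rewrite /f0 unlift_none.
  have f0l j : f0 (lift ord0 j) = s j x by rewrite /f0 liftK.
  move=> k; rewrite big_ord_recl f00; under eq_bigr do rewrite f0l.
  move=> k0; have kord0 : k ord0 = 0.
    have := congr1 (dot (X c)) k0; rewrite dot0r dotDr dotZr linear_sum/= big1.
      rewrite addr0 => /eqP; rewrite mulf_eq0 => /orP[/eqP//|/eqP/dot_eq0//].
    move=> j _; rewrite dotZr (commuting_sym Gorth cb)//.
    by rewrite Xx dot0r mulr0.
  move: k0; rewrite kord0 scale0r add0r => /sx kl i.
  by case: (unliftP ord0 i) => [j ->|->].
have : \forall n \near U, l1 (small n *: c) < eps - l1 (x - w).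
  have : ulim U (fun n => small n *: c) 0.
    by rewrite -(scale0r c); apply: ulimZ; [exact: small_cvg|exact: ulim_cst].
  have e0 : 0 < eps - l1 (x - w) by rewrite subr_gt0.
  by move=> /(near_ulim_lt e0); apply: filterS => n; rewrite subr0.
move=> /filterI/[apply] /filter_ex[n [/= small_c fn]].
have : `[< P r.+1 >].
  apply/asboolP; exists (x + small n *: c).
  exists (fun i => if unlift ord0 i is Some j then s j else X); split.
  - by rewrite memvD// memvZ.
  - by rewrite addrAC; apply: le_lt_trans (l1D _ _) _; rewrite -ltrBrDl.
  - by move=> i; case: unliftP.
  move=> k k0.
  (* As X x = 0, X maps x + t c to t X c: the family at the new point is [f n] with its first vector
     scaled by t > 0. *)
  pose k' i := if unlift ord0 i is Some j then k i else small n * k i.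
  have kk' i : k' i = 0 -> k i = 0.
    rewrite /k'; case: unliftP => // _ /eqP.
    by rewrite mulf_eq0 gt_eqF ?small_gt0//= => /eqP.
  move=> i; apply: kk'; move: i; apply: fn; rewrite -[RHS]k0.
  apply: eq_bigr => i _; rewrite /k' /f; case: unliftP => // _.
  by rewrite linearD/= linearZ/= Xx add0r scalerA mulrC.
by move=> /rmax; rewrite ltnn.
Qed.

(** A minimizing sequence converges along [U] by compactness of G. The last hypothesis says that [S]
    is closed and [f] is continuous on it, in the form in which limits are available. *)
Lemma grp_argmin (S : set 'End(V)) (f : 'End(V) -> R) (m : R) :
  S `<=` G -> S !=set0 -> (forall g, S g -> m <= f g) ->
  (forall (U : set_system nat) (g : nat -> 'End(V)) h, UltraFilter U ->
     (forall n, S (g n)) -> ulim U g h ->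
     S h /\ f (g n) @[n --> U] --> f h) ->
  exists2 h, S h & forall g, S g -> f h <= f g.
Proof.
move=> SG [g0 Sg0] fm Sclosed; have [U [UF Uoo]] := ultra_infty.
have hi : has_inf [set f g | g in S].
  split; first by exists (f g0), g0.
  by exists m => _ [g Sg <-]; exact: fm.
pose i := inf [set f g | g in S].
have /choice[g gP] (n : nat) : exists g, S g /\ f g < i + small n.
  have [_ [g Sg <-] fg] := inf_adherent (small_gt0 n) hi.
  by exists g.
have [|h Gh gh] := @grp_ulim _ _ _ Gcompact U _ g.
  by apply: nearW => n; apply: SG; have [] := gP n.
have [Sh fgh] := Sclosed U g h UF (fun n => (gP n).1) gh.
exists h => // h' Sh'; apply: (@le_trans _ _ i); last first.
  by apply: ge_inf; [case: hi|exists h'].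
have lim : i + small n @[n --> U] --> i + 0.
  by apply: cvgD; [exact: cvg_cst|exact: small_cvg].
rewrite -[i]addr0; apply: ler_cvg_to fgh lim _.
by apply: nearW => n; apply: ltW; have [] := gP n.
Qed.

Lemma minimal_representative b g : G g -> exists h, [/\ G h,
  forall c, c \in b -> h c = g c &
  forall h', G h' -> (forall c, c \in b -> h' c = g c) ->
    l1 (h - \1)%VF <= l1 (h' - \1)%VF].
Proof.
move=> Gg.
have [|||U k h UF kS kh|h [Gh hb] hmin] := @grp_argmin
  [set h | G h /\ forall c, c \in b -> h c = g c] (fun h => l1 (h - \1)%VF) 0.
- by move=> h [].
- by exists g.
- by move=> h _; exact: l1_ge0.
- split; last by apply: ulim_l1; apply: ulimB => //; exact: ulim_cst.
  have [|h' Gh' kh'] := @grp_ulim _ _ _ Gcompact U _ k.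
    by apply: nearW => n; have [] := kS n.
  rewrite (ulim_unique kh kh'); split=> // c cb.
  apply: (@ulim_unique _ U _ _ (fun n => k n c)).
    by apply: ulim_app => //; exact: ulim_cst.
  apply: (near_ulim _ (ulim_cst (g c))); apply: nearW => n.
  by have [_ ->] := kS n.
exists h; split=> // h' Gh' hb'; exact: hmin.
Qed.

(* h_n is the element closest to 1 among those that agree with g_n on b. If X
   vanished on b, then h_n gam(- r_n) would also agree with g_n on b, but be
   closer to 1. *)
Lemma grp_blowup (U : set_system nat) {UF : UltraFilter U} b
    (g : nat -> 'End(V)) (y : nat -> V) :
  (\forall n \near U, G (g n)) -> ulim U g \1%VF ->
  (\forall n \near U, y n \in b) -> (\forall n \near U, g n (y n) <> y n) ->
  exists (h : nat -> 'End(V)) (r : nat -> R) X,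
    [/\ \forall n \near U, forall c, c \in b -> h n c = g n c,
        \forall n \near U, 0 < r n,
        ulim U (fun n => (r n)^-1 *: (h n - \1)%VF) X,
        lie_alg G X &
        exists2 c, c \in b & X c <> 0].
Proof.
move=> Gg g1 yb gy.
have /choice[h hP] (n : nat) : exists h, G (g n) -> [/\ G h,
  forall c, c \in b -> h c = g n c &
  forall h', G h' -> (forall c, c \in b -> h' c = g n c) ->
    l1 (h - \1)%VF <= l1 (h' - \1)%VF].
  have [Gn|ng] := pselect (G (g n)); last by exists \1%VF.
  by have [h hP] := minimal_representative b Gn; exists h.
pose r n := l1 (h n - \1)%VF.
have r0 : r n @[n --> U] --> (0 : R).
  apply: cvg_le0 g1; apply: filterS Gg => n Gn.
  by have [_ _ hm] := hP n Gn; rewrite l1_ge0/= hm.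
have r_gt0 : \forall n \near U, 0 < r n.
  apply: filterS3 Gg yb gy => n Gn yn gyn.
  have [_ hb _] := hP n Gn; rewrite lt_neqAle l1_ge0 andbT eq_sym.
  apply/eqP => /l1_eq0/eqP; rewrite subr_eq0 => /eqP h1.
  by apply: gyn; rewrite -hb// h1 id_lfunE.
have h1 : ulim U h \1%VF by [].
pose D n := (r n)^-1 *: (h n - \1)%VF.
have D1 : \forall n \near U, l1 (D n) = 1.
  apply: filterS r_gt0 => n rn.
  by rewrite /D l1Z gtr0_norm ?invr_gt0// mulVf// gt_eqF.
have [X DX] : exists X, ulim U D X.
  by apply: (@bounded_ulim _ _ _ _ _ 1); apply: filterS D1 => n ->.
have Gh : \forall n \near U, G (h n).
  by apply: filterS Gg => n Gn; have [] := hP n Gn.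
have lX : lie_alg G X by exact: (lie_alg_quotient Gorth Gcompact Gh r_gt0).
exists h, r, X; split=> //.
  by apply: filterS Gg => n Gn; have [] := hP n Gn.
apply: contrapT => /forall2NP Xb.
have {}Xb c : c \in b -> X c = 0 by move=> cb; have [|/contrapT] := Xb c.
have [gam [C [Ggam gamC gamX]]] := lX.
have [M M0 [_ hM]] := grp_act_bounded Gcompact.
have [K K0 cK] := comp_bounded (V := V).
(* The distance from h_n gam(- r_n) to 1 is at most r_n times this null sequence, but at least r_n
   since h_n is closest to 1. The three terms match the decomposition of h_n gam(- r_n) - 1
   below. *)
have lim : M * C * r n + l1 (D n - X) + K * l1 (h n - \1)%VF * l1 X
    @[n --> U] --> M * C * 0 + 0 + K * 0 * l1 X.
  apply: cvgD; first by apply: cvgD => //; exact: cvgMl_tmp.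
  by apply: cvgMr_tmp; exact: cvgMl_tmp.
rewrite !mulr0 mul0r !addr0 in lim.
suff : (1 : R) <= 0 by rewrite ler10.
apply: (cvgr_to_ge lim).
have r1 : \forall n \near U, r n <= 1.
  by apply: filterS (near_ulim_lt ltr01 h1) => n /ltW.
apply: filterS3 Gg r_gt0 r1 => n Gn rn rn1.
have [Ghn hb hmin] := hP n Gn.
have hb' c : c \in b -> (h n \o gam (- r n))%VF c = g n c.
  by move=> cb; rewrite comp_lfunE gamX ?Xb// hb.
rewrite -(ler_pM2l rn) mulr1.
apply: le_trans (hmin _ (grpM Gorth Ghn (Ggam _)) hb') _.
have -> : (h n \o gam (- r n) - \1 =
  h n \o (gam (- r n) - \1 - (- r n) *: X) + (h n - \1 - r n *: X)
    - r n *: ((h n - \1) \o X))%VF.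
  apply/lfunP => v.
  rewrite !(comp_lfunE, add_lfunE, opp_lfunE, scale_lfunE, id_lfunE).
  rewrite scaleNr opprK scalerBr linearD/= linearB/= [h n (r n *: _)]linearZ/=.
  by rewrite addrACA addrK subrKA.
apply: le_trans (l1B _ _) _; rewrite mulrDr lerD//; last first.
  by rewrite l1Z gtr0_norm// ler_wpM2l ?(ltW rn)//; exact: cK.
apply: le_trans (l1D _ _) _; rewrite mulrDr lerD//; last first.
  have -> : (h n - \1 - r n *: X)%VF = r n *: (D n - X).
    by rewrite scalerBr /D scalerKV ?lt0r_neq0.
  by rewrite l1Z gtr0_norm.
apply: le_trans (hM _ _ Ghn) _.
rewrite [leRHS](_ : _ = M * (C * r n ^+ 2)); last by ring.
rewrite ler_wpM2l ?(ltW M0)// -[r n ^+ 2]sqrrN; apply: gamC.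
by rewrite normrN gtr0_norm.
Qed.

Lemma regular_limit (U : set_system nat) {UF : UltraFilter U} a b x
    (k : nat -> 'End(V)) l (z : nat -> V) :
  commuting dot G a -> commuting dot G b -> x \in b -> regular b x ->
  (\forall n \near U, G (k n)) -> G l -> ulim U k l ->
  (\forall n \near U, z n \in b) -> ulim U z x ->
  (\forall n \near U, k n (z n) \in a) ->
  \forall n \near U, k n (z n) = l (z n).
Proof.
move=> ca cb xb rx Gk Gl kl zb zx kza.
have [//|nk] := in_ultra_setVsetC [set n | k n (z n) = l (z n)] UF.
pose g n := (l^-1 \o k n)%VF.
have [||||h [r [X [hb r0 DX lX [c cb' []]]]]] := @grp_blowup U UF b g z.
- by apply: filterS Gk => n Gn; apply: (grpM Gorth) => //; exact: (grpV Gorth).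
- have <- : (l^-1 \o l)%VF = \1%VF.
    by apply/lfunP => v; rewrite comp_lfunE id_lfunE (grpVK Gorth).
  by apply: ulim_comp => //; exact: ulim_cst.
- exact: zb.
- apply: filterS nk => n /= nk gz; apply: nk.
  by rewrite -[in RHS]gz comp_lfunE (grpKV Gorth).
(* Regularity reduces X c = 0 to X x = 0. Now <X x, X x> is the limit of <X x, (h_n z_n - z_n) /
   r_n>, and each term is 0: X x is orthogonal to z_n because both x and z_n are in b, and to h_n
   z_n = l^-1 k_n z_n because l X l^-1 can be paired with l x and k_n z_n in a. *)
apply: rx => //; apply: (@dot_eq0 _ _ dot).
have lxa : l x \in a.
  by apply: memv_ulim kza; exact: ulim_app.
have : dot (X x) (((r n)^-1 *: (h n - \1)%VF) (z n)) @[n --> U] -->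
    dot (X x) (X x).
  by apply: cvg_dot; [exact: ulim_cst|exact: ulim_app].
move=> /cvg_eq0; apply.
apply: filterS3 hb zb kza => n hn zn kzn.
rewrite scale_lfunE add_lfunE opp_lfunE id_lfunE dotZr dotBr hn//.
rewrite (cb x (z n))// subr0 comp_lfunE.
have lJ : lie_alg G ((l^-1)^-1 \o X \o l^-1)%VF.
  by apply: (lie_algJ Gorth) => //; exact: (grpV Gorth).
have := ca _ _ _ lxa kzn lJ.
rewrite !comp_lfunE (grpVK Gorth)// (dotVl Gorth); last exact: (grpV Gorth).
by move=> ->; rewrite mulr0.
Qed.

Lemma commuting_into a b : cartan_subspace dot G a -> commuting dot G b ->
  exists2 k, G k & (k @: b <= a)%VS.
Proof.
move=> Ca cb; have [U [UF Uoo]] := ultra_infty.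
have ca := cartan_commuting Ca.
have [x [xb _ rx]] := regular_dense cb (mem0v b) ltr01.
(* The leading coefficient makes the curve tend to the regular point; the others make it span b. *)
pose z n := vhorner (small n) (x :: vbasis b).
have /choice[k kP] (n : nat) : exists k, G k /\ k (z n) \in a.
  by have [_ [k Gk <-] ka] := Ca.1 (z n); exists k.
have [|l Gl kl] := @grp_ulim _ _ _ Gcompact U _ k.
  by apply: nearW => n; have [] := kP n.
exists l => //; apply: (@vhorner_subspace _ _ U _ Uoo _ _ _ x).
have kza n : k n (z n) \in a by have [] := kP n.
have zb n : z n \in b.
  apply: memv_vhorner => u.
  by rewrite in_cons => /predU1P[->//|]; exact: vbasis_mem.
have zx : ulim U z x by exact: vhorner_cvg.
have Gk : \forall n \near U, G (k n) by apply: nearW => n; have [] := kP n.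
have : \forall n \near U, k n (z n) = l (z n).
  by apply: (regular_limit ca cb xb rx Gk Gl kl) => //; exact: nearW.
by apply: filterS => n <-.
Qed.

End regular_points.

(** * Maximizing <w, g u> *)

Section weyl_elements.
Context {R : realType} {V : vectType R} {dot : {dot V for idfun}}.
Context {G : set 'End(V)}.
Hypothesis Gorth : orthogonal_subgroup dot G.
Hypothesis Gcompact : compact_endomorphisms G.
Implicit Types (g h X Y Z : 'End(V)) (u v w x y : V) (a b : {vspace V}).

(** The first variation gives <w, X y> <= 0 for X and for - X, hence <w, X y> = 0. Skewness settles
    the remaining pairings of w and y. *)
Lemma maximizer_commuting w y : (forall h, G h -> dot w (h y) <= dot w y) ->
  commuting dot G (<[w]> + <[y]>)%VS.
Proof.
move=> wy; have [U [UF Uoo]] := ultra_infty.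
have wXy_le X : lie_alg G X -> dot w (X y) <= 0.
  move=> /(lie_alg_seq Uoo)[g Gg gX].
  have lim : dot w (((small n)^-1 *: (g n - \1)%VF) y) @[n --> U] -->
      dot w (X y).
    by apply: cvg_dot; [exact: ulim_cst|apply: ulim_app => //; exact: ulim_cst].
  apply: (cvgr_to_le lim); apply: nearW => n.
  rewrite scale_lfunE dotZr add_lfunE opp_lfunE id_lfunE dotBr.
  rewrite pmulr_rle0 ?invr_gt0 ?small_gt0// subr_le0.
  exact: wy.
have wXy X : lie_alg G X -> dot w (X y) = 0.
  move=> lX; apply/eqP; rewrite eq_le wXy_le//=.
  by have := wXy_le _ (lie_algN lX); rewrite opp_lfunE -sub0r dotBr dot0r; lra.
have vXv X v : lie_alg G X -> dot (X v) v = 0.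
  by move=> /(lie_alg_skew Gorth v v); rewrite [dot v _]dotC; lra.
move=> x z X /memv_addP[_ /vlineP[c1 ->] [_ /vlineP[c2 ->] ->]].
move=> /memv_addP[_ /vlineP[c3 ->] [_ /vlineP[c4 ->] ->]] lX.
have -> : X (c1 *: w + c2 *: y) = c1 *: X w + c2 *: X y.
  by rewrite linearD !linearZ.
rewrite dotDl !dotDr !dotZl !dotZr !vXv//.
rewrite (lie_alg_skew Gorth w y lX) [dot (X y) w]dotC wXy//.
by rewrite oppr0 !mulr0 !addr0.
Qed.

Lemma maximizer_exists w u :
  exists2 g, G g & forall h, G h -> dot w (h u) <= dot w (g u).
Proof.
have [||g Gg||g Gg gmax] := grp_argmin Gcompact (S := G)
  (f := fun g => - dot w (g u)) (m := - ((dot w w + dot u u) / 2)).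
- by [].
- by exists \1%VF; exact: (grp1 Gorth).
(* The lower bound comes from <w - g u, w - g u> >= 0, as g is an isometry. *)
- have := dot_ge0 dot (w - g u).
  rewrite dotBl !dotBr (grp_dot Gorth Gg) [dot (g u) w]dotC; lra.
- move=> U g h UF Gg gh.
  have [|h' Gh' gh'] := @grp_ulim _ _ _ Gcompact U _ g; first exact: nearW.
  split; first by rewrite (ulim_unique gh gh').
  apply: cvgN; apply: cvg_dot; first exact: ulim_cst.
  by apply: ulim_app => //; exact: ulim_cst.
by exists g => // h Gh; rewrite -lerN2; exact: gmax.
Qed.

(** These elements induce the Weyl group on a; using them in place of their restrictions keeps the
    argument inside [V]. *)
Definition stabilizes a g : Prop := G g /\ (g @: a)%VS = a.

Lemma stabilizes_sub a g : G g -> (g @: a <= a)%VS -> stabilizes a g.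
Proof.
move=> Gg ga; split=> //; apply/eqP; rewrite eqEdim ga/= limg_dim_eq//.
by have /eqP -> := grp_lker0 Gorth Gg; rewrite capv0.
Qed.

Lemma stabilizes_factor a k g : G g -> stabilizes a k ->
  stabilizes a (k \o g)%VF -> stabilizes a g.
Proof.
move=> Gg [Gk ka] [_ kga]; apply: stabilizes_sub => //.
apply/subvP => _ /memv_imgP[v va ->].
have : k (g v) \in a by rewrite -comp_lfunE -kga memv_img.
rewrite -{1}ka => /memv_imgP[v' v'a /(congr1 (k^-1)%VF)].
by rewrite !(grpVK Gorth)// => ->.
Qed.

Lemma stabilizes_ulim (U : set_system nat) {UF : UltraFilter U} a
    (g : nat -> 'End(V)) h : (\forall n \near U, stabilizes a (g n)) ->
  G h -> ulim U g h -> stabilizes a h.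
Proof.
move=> ga Gh gh; apply: stabilizes_sub => //.
apply/subvP => _ /memv_imgP[v va ->].
apply: (@memv_ulim _ _ U _ a (fun n => g n v)).
  by apply: ulim_app => //; exact: ulim_cst.
by apply: filterS ga => n [_ <-]; exact: memv_img.
Qed.

Lemma regular_maximizer a w u : cartan_subspace dot G a ->
  w \in a -> regular (G := G) a w -> u \in a -> regular (G := G) a u ->
  exists2 g, stabilizes a g & forall h, G h -> dot w (h u) <= dot w (g u).
Proof.
move=> Ca wa rw ua ru; have [U [UF Uoo]] := ultra_infty.
have ca := cartan_commuting Ca.
pose z x n := vhorner (small n) (x :: vbasis a).
have za x n : x \in a -> z x n \in a.
  move=> xa; apply: memv_vhorner => v.
  by rewrite in_cons => /predU1P[->//|]; exact: vbasis_mem.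
have zx x : ulim U (z x) x by exact: vhorner_cvg.
have /choice[g gP] (n : nat) : exists g, G g /\
    forall h, G h -> dot (z w n) (h (z u n)) <= dot (z w n) (g (z u n)).
  by have [g Gg gmax] := maximizer_exists (z w n) (z u n); exists g.
have /choice[k kP] (n : nat) : exists k, [/\ G k, k (z w n) \in a &
    k (g n (z u n)) \in a].
  have [Gn gmax] := gP n.
  have [|k Gk /subvP ka] := commuting_into Gorth Gcompact Ca
      (b := (<[z w n]> + <[g n (z u n)]>)%VS).
    apply: maximizer_commuting => h Gh.
    by rewrite -comp_lfunE; apply: gmax; exact: (grpM Gorth).
  exists k; split=> //; apply: ka; apply: memv_img.
    by apply: (subvP (addvSl _ _)); exact: memv_line.
  by apply: (subvP (addvSr _ _)); exact: memv_line.
have Gk : \forall n \near U, G (k n) by apply: nearW => n; have [] := kP n.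
have Gg : \forall n \near U, G (g n) by apply: nearW => n; have [] := gP n.
have Gkg : \forall n \near U, G (k n \o g n)%VF.
  by apply: filterS2 Gk Gg => n; exact: (grpM Gorth).
have [g0 Gg0 gg0] := grp_ulim Gcompact Gg.
have [k0 Gk0 kk0] := grp_ulim Gcompact Gk.
have Gkg0 := grpM Gorth Gk0 Gg0.
(* On the curve through the regular point w, k_n agrees with its limit, which therefore maps the
   curve, and with it a, into a. The same is then done for k_n g_n on the curve through u, and g0 is
   obtained by cancelling k0. *)
have sk : stabilizes a k0.
  apply: stabilizes_sub => //; apply: (@vhorner_subspace _ _ U _ Uoo _ _ _ w).
  have : \forall n \near U, k n (z w n) = k0 (z w n).
    apply: (regular_limit Gorth Gcompact ca ca wa rw Gk Gk0 kk0) => //.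
      by apply: nearW => n; exact: za.
    by apply: nearW => n; have [] := kP n.
  by apply: filterS => n <-; have [] := kP n.
have skg : stabilizes a (k0 \o g0)%VF.
  apply: stabilizes_sub => //; apply: (@vhorner_subspace _ _ U _ Uoo _ _ _ u).
  have : \forall n \near U, (k n \o g n)%VF (z u n) = (k0 \o g0)%VF (z u n).
    apply: (regular_limit Gorth Gcompact ca ca ua ru Gkg Gkg0) => //.
    - exact: ulim_comp.
    - by apply: nearW => n; exact: za.
    by apply: nearW => n; rewrite comp_lfunE; have [] := kP n.
  by apply: filterS => n <-; rewrite comp_lfunE; have [] := kP n.
exists g0; first exact: stabilizes_factor sk skg.
move=> h Gh.
have l1 : dot (z w n) (h (z u n)) @[n --> U] --> dot w (h u).
  by apply: cvg_dot => //; apply: ulim_app => //; exact: ulim_cst.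
have l2 : dot (z w n) (g n (z u n)) @[n --> U] --> dot w (g0 u).
  by apply: cvg_dot => //; exact: ulim_app.
by apply: ler_cvg_to l1 l2 _; apply: nearW => n; have [_] := gP n; apply.
Qed.

(** Approximate w and u by regular points: the maximizers converge along an ultrafilter, the
    stabilizer of a is closed, and the inequalities pass to the limit. *)
Lemma weyl_maximizer a w u : cartan_subspace dot G a -> w \in a -> u \in a ->
  exists2 g, stabilizes a g & forall h, G h -> dot w (h u) <= dot w (g u).
Proof.
move=> Ca wa ua; have [U [UF Uoo]] := ultra_infty.
have ca := cartan_commuting Ca.
have approx x : x \in a -> exists2 z : nat -> V,
    forall n, z n \in a /\ regular (G := G) a (z n) & ulim U z x.
  move=> xa; have /choice[z zP] (n : nat) : exists z, [/\ z \in a,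
      l1 (z - x) < small n & regular (G := G) a z].
    exact: (regular_dense Gorth ca xa (small_gt0 n)).
  exists z; first by move=> n; have [] := zP n.
  apply: (@ulim_le _ _ _ _ _ _ small); last exact: small_cvg.
  by apply: nearW => n; have [_ /ltW] := zP n.
have [zw zwP zww] := approx _ wa; have [zu zuP zuu] := approx _ ua.
have /choice[g gP] (n : nat) : exists g, stabilizes a g /\
    forall h, G h -> dot (zw n) (h (zu n)) <= dot (zw n) (g (zu n)).
  have [[wna rw] [una ru]] := (zwP n, zuP n).
  by have [g] := regular_maximizer Ca wna rw una ru; exists g.
have [|g0 Gg0 gg0] := @grp_ulim _ _ _ Gcompact U _ g.
  by apply: nearW => n; have [[]] := gP n.
exists g0.
  by apply: stabilizes_ulim Gg0 gg0; apply: nearW => n; have [] := gP n.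
move=> h Gh.
have l1 : dot (zw n) (h (zu n)) @[n --> U] --> dot w (h u).
  by apply: cvg_dot => //; apply: ulim_app => //; exact: ulim_cst.
have l2 : dot (zw n) (g n (zu n)) @[n --> U] --> dot w (g0 u).
  by apply: cvg_dot => //; exact: ulim_app.
by apply: ler_cvg_to l1 l2 _; apply: nearW => n; have [_] := gP n; apply.
Qed.

(** In an infinite orbit choose g_n with distinct g_n u. The line through u is commuting and u is
    regular in it, so [regular_limit], with u as a constant sequence, makes g_n u equal to its limit
    for [U]-almost all n. *)
Lemma finite_weyl_orbit a u : cartan_subspace dot G a -> u \in a ->
  finite_set [set g u | g in stabilizes a].
Proof.
move=> Ca ua; apply: contrapT => /infiniteP/card_leP/unsquash f.
pose i n : [set: nat] := SigSub (mem_set (I : setT n)).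
have [U [UF Uoo]] := ultra_infty.
have ca := cartan_commuting Ca.
have /choice[g gP] (n : nat) : exists g, stabilizes a g /\ g u = \val (f (i n)).
  by have /set_mem[g ga gu] := valP (f (i n)); exists g.
have Gg : \forall n \near U, G (g n) by apply: nearW => n; have [[]] := gP n.
have [g0 Gg0 gg0] := grp_ulim Gcompact Gg.
have cu : commuting dot G <[u]>.
  move=> _ _ X /vlineP[c1 ->] /vlineP[c2 ->] lX.
  by rewrite [X _]linearZ/= dotZl dotZr ca// !mulr0.
have ru : regular (G := G) <[u]> u.
  by move=> X lX Xu _ /vlineP[c ->]; rewrite linearZ/= Xu scaler0.
have gu : \forall n \near U, g n u = g0 u.
  apply: (regular_limit (z := fun=> u) Gorth Gcompact ca cu _ ru Gg Gg0 gg0).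
  - exact: memv_line.
  - by apply: nearW => n; exact: memv_line.
  - exact: ulim_cst.
  - by apply: nearW => n; have [[_ ga] _] := gP n; rewrite -ga memv_img.
have [n gn] := filter_ex gu.
have [m [gm /= nm]] : exists m, g m u = g0 u /\ (n < m)%N.
  have : U [set m | (n < m)%N] by apply: Uoo; exists n.+1.
  by move=> /(filterI gu) /filter_ex[m []]; exists m.
have : f (i m) = f (i n).
  by apply: val_inj; have [[_ <-] [_ <-]] := (gP m, gP n); rewrite gm gn.
move=> /(@inj _ _ _ f) => /(_ (mem_set I) (mem_set I)) /(congr1 \val)/= mn.
by rewrite mn ltnn in nm.
Qed.

End weyl_elements.

(** * Invariant convex sets *)

Section convexity.
Context {R : realType} {V : vectType R}.
Implicit Types (A B K : set V).

Lemma convex_setP A : convex_set (A : set (convex_lmodType V)) <->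
  forall x y (t : R), A x -> A y -> 0 <= t -> t <= 1 ->
    A (t *: x + (1 - t) *: y).
Proof.
split=> [cA x y t Ax Ay t0 t1|cA x y t /set_mem Ax /set_mem Ay].
  exact: (set_mem (cA x y (Itv01 t0 t1) (mem_set Ax) (mem_set Ay))).
by apply/mem_set; exact: cA.
Qed.

Lemma convex_comb A n (c : 'I_n -> R) (f : 'I_n -> V) :
  convex_set (A : set (convex_lmodType V)) -> (forall i, A (f i)) ->
  (forall i, 0 <= c i) -> \sum_i c i = 1 -> A (\sum_i c i *: f i).
Proof.
move=> /convex_setP cA; elim: n c f => [|n IH] c f Af c0.
  by rewrite big_ord0 => /esym/eqP; rewrite oner_eq0.
rewrite !big_ord_recl; set s := \sum_(i < n) _ => c1.
have s0 : 0 <= s by exact: sumr_ge0.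
have [sz|sn0] := eqVneq s 0.
  rewrite big1 => [|i _].
    by move: c1; rewrite sz !addr0 => ->; rewrite scale1r.
  have : c (lift ord0 i) = 0.
    apply/eqP; rewrite eq_le c0 andbT -sz /s (bigD1 i)//= lerDl.
    by apply: sumr_ge0.
  by move=> ->; rewrite scale0r.
have -> : \sum_(i < n) c (lift ord0 i) *: f (lift ord0 i) =
    (1 - c ord0) *: \sum_(i < n) (s^-1 * c (lift ord0 i)) *: f (lift ord0 i).
  have -> : 1 - c ord0 = s by rewrite -c1; ring.
  rewrite scaler_sumr; apply: eq_bigr => i _.
  by rewrite scalerA mulrA mulfV// mul1r.
apply: cA => //; last by rewrite -c1 lerDl.
apply: IH => // [i|]; first by rewrite mulr_ge0// invr_ge0.
by rewrite -mulr_sumr mulVf.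
Qed.

Variable dot : {dot V for idfun}.

(** Let q be the point of the hull closest to p, and w = p - q. Then <w, f i - q> <= 0 for all i,
    while the hypothesis yields an i with <w, p> <= <w, f i>; hence <w, w> <= 0. Only such w are
    tested, because in the application they have to lie in a. *)
Lemma finite_separation n (f : 'I_n -> V) (p : V) :
  (forall c : 'I_n -> R, (forall i, 0 <= c i) -> \sum_i c i = 1 ->
     let w := p - \sum_i c i *: f i in exists i, dot w p <= dot w (f i)) ->
  'I_n ->
  exists c : 'I_n -> R,
    [/\ forall i, 0 <= c i, \sum_i c i = 1 & p = \sum_i c i *: f i].
Proof.
move=> fp i0; have [U [UF Uoo]] := ultra_infty.
pose simplex := [set c : 'I_n -> R | (forall i, 0 <= c i) /\ \sum_i c i = 1].
pose q (c : 'I_n -> R) := \sum_i c i *: f i.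
pose F c := dot (p - q c) (p - q c).
have s0 : simplex (fun i => (i == i0)%:R).
  split; first by move=> i; rewrite ler0n.
  by rewrite (bigD1 i0)//= eqxx big1 ?addr0// => i /negPf ->.
have hi : has_inf [set F c | c in simplex].
  split; first by eexists; exact: (imageP F s0).
  by exists 0 => _ [c _ <-]; exact: dot_ge0.
pose m := inf [set F c | c in simplex].
have /choice[c cP] (k : nat) : exists c, simplex c /\ F c < m + small k.
  by have [_ [c sc <-] fc] := inf_adherent (small_gt0 k) hi; exists c.
have /choice[l cl] (i : 'I_n) : exists l : R, c k i @[k --> U] --> l.
  apply: (@ultra_bounded_cvg _ _ _ _ 1); apply: nearW => k.
  have [[c0 <-] _] := cP k; rewrite ger0_norm// (bigD1 i)//= lerDl.
  by apply: sumr_ge0.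
have l0 i : 0 <= l i.
  apply: (cvgr_to_ge (cl i)); apply: nearW => k.
  by have [[+ _] _] := cP k; apply.
have l1 : \sum_i l i = 1.
  have : \sum_i c k i - 1 @[k --> U] --> \sum_i l i - 1.
    by apply: cvgB; [exact: cvg_sumr|exact: cvg_cst].
  move=> /cvg_eq0 => /(_ _)/eqP; rewrite subr_eq0 => /(_ _)/eqP; apply.
  by apply: nearW => k; have [[_ ->] _] := cP k; rewrite subrr.
exists l; split=> //; rewrite -[RHS]/(q l).
have ql : ulim U (fun k => p - q (c k)) (p - q l).
  apply: ulimB; first exact: ulim_cst.
  by apply: ulim_sum => i; apply: ulimZ; [exact: cl|exact: ulim_cst].
have Fl : F l <= m.
  have lim : m + small k @[k --> U] --> m + 0.
    by apply: cvgD; [exact: cvg_cst|exact: small_cvg].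
  rewrite -[m]addr0; apply: ler_cvg_to (cvg_dot ql ql) lim _.
  by apply: nearW => k; have [_ /ltW] := cP k.
have [i] := fp l l0 l1; rewrite /= -/(q l); set w := p - q l => wp.
set d := f i - q l.
have wd : dot w d <= 0.
  (* Moving q towards f i by the fraction t stays in the hull and cannot decrease the distance to
     p. *)
  have step (t : R) : 0 <= t -> t <= 1 ->
      dot w w <= dot w w - 2 * t * dot w d + t ^+ 2 * dot d d.
    move=> t0 t1; pose c' j := (1 - t) * l j + t * (j == i)%:R.
    have qc' : p - q c' = w - t *: d.
      have -> : q c' = q l + t *: d.
        rewrite /q /c'; under eq_bigr do rewrite scalerDl -!scalerA.
        rewrite big_split/= -!scaler_sumr -/(q l).
        rewrite [X in _ + t *: X](_ : _ = f i).
          by rewrite /d scalerBl scale1r scalerBr -addrA [- _ + _]addrC.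
        rewrite (bigD1 i)//= eqxx scale1r big1 ?addr0// => j /negPf ->.
        by rewrite scale0r.
      by rewrite opprD addrA.
    have sc' : simplex c'.
      split=> [j|]; first by rewrite addr_ge0// mulr_ge0// subr_ge0.
      rewrite big_split/= -!mulr_sumr l1 (bigD1 i)//= eqxx.
      by rewrite big1 ?addr0 ?mulr1 ?subrK// => j /negPf ->.
    have : m <= F c' by apply: ge_inf; [case: hi|exists c'].
    move=> /(le_trans Fl); rewrite /F qc' -/w => /le_trans; apply.
    by rewrite dot_subZ.
  rewrite leNgt; apply/negP => a0; have b0 := dot_ge0 dot d.
  (* This t lies in (0, 1] and satisfies t <d, d> <= <w, d>, against 2 <w, d> <= t <d, d> from
     [step]. *)
  pose t := dot w d / (dot w d + dot d d).
  have ab0 : 0 < dot w d + dot d d by rewrite ltr_wpDr.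
  have t0 : 0 < t by rewrite divr_gt0.
  have t1 : t <= 1 by rewrite ler_pdivrMr// mul1r lerDl.
  have tb : t * dot d d <= dot w d.
    by rewrite mulrAC ler_pdivrMr// ler_pM2l// lerDr ltW.
  have h : t * (2 * dot w d) <= t * (t * dot d d).
    by have := step t (ltW t0) t1; lra.
  by rewrite ler_pM2l// in h; lra.
have : dot w w <= 0.
  by move: wp wd; rewrite /d {1 3}/w dotBr => *; rewrite dotBr; lra.
move=> ww; have /(@dot_eq0 _ _ dot)/eqP : dot w w = 0.
  by apply/eqP; rewrite eq_le ww dot_ge0.
by rewrite subr_eq0 => /eqP.
Qed.

End convexity.

Section minkowski.
Context {R : realType} {L : vectType R}.

Lemma convex_minkowski (A B : set L) :
  convex_set (A : set (convex_lmodType L)) ->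
  convex_set (B : set (convex_lmodType L)) ->
  convex_set (minkowski_add A B : set (convex_lmodType L)).
Proof.
move=> /convex_setP cA /convex_setP cB; apply/convex_setP.
move=> _ _ t [a Aa [b Bb <-]] [a' Aa' [b' Bb' <-]] t0 t1.
exists (t *: a + (1 - t) *: a'); first exact: cA.
exists (t *: b + (1 - t) *: b'); first exact: cB.
by rewrite !scalerDr addrACA.
Qed.

Lemma invariant_convex_semigroup (H : set 'End(L)) :
  is_semigroup minkowski_add (invariant_convex H).
Proof.
split=> [A B [cA HA] [cB HB]|A B C _ _ _].
  split=> [|h Hh]; first exact: convex_minkowski.
  rewrite -{2}(HA _ Hh) -{2}(HB _ Hh) eqEsubset; split.
    move=> _ [_ [a Aa [b Bb <-]] <-]; exists (h a); first by exists a.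
    by exists (h b); [exists b|rewrite linearD].
  move=> _ [_ [a Aa <-] [_ [b Bb <-] <-]].
  by exists (a + b); [exists a => //; exists b|rewrite linearD].
rewrite eqEsubset; split.
  move=> _ [a Aa [_ [b Bb [c Cc <-]] <-]].
  by exists (a + b); [exists a => //; exists b|exists c => //; rewrite addrA].
move=> _ [_ [a Aa [b Bb <-]] [c Cc <-]].
by exists a => //; exists (b + c); [exists b => //; exists c|rewrite addrA].
Qed.

End minkowski.

(** * Traces of invariant convex sets on the Cartan subspace *)

Section polar.
Context {R : realType} {V : vectType R} {dot : {dot V for idfun}}.
Context {G : set 'End(V)} {a : {vspace V}}.
Hypothesis Gorth : orthogonal_subgroup dot G.
Hypothesis Gcompact : compact_endomorphisms G.
Hypothesis Ga : cartan_subspace dot G a.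
Implicit Types (g h : 'End(V)) (u v w x y : V).

Lemma stabilizes_memv n v : stabilizes (G := G) a n -> v \in a -> n v \in a.
Proof. by move=> [_ na] va; rewrite -na memv_img. Qed.

(* Every w in a takes at least its value at p on one of the finitely many
   points s n c1 + t n' c2, so p cannot be separated from their convex hull. *)
Lemma weyl_hull (K : set V) (s t : R) g1 g2 c1 c2 :
  convex_set (K : set (convex_lmodType V)) ->
  0 <= s -> 0 <= t -> G g1 -> G g2 -> c1 \in a -> c2 \in a ->
  (forall n n', stabilizes (G := G) a n -> stabilizes (G := G) a n' ->
     K (s *: n c1 + t *: n' c2)) ->
  s *: g1 c1 + t *: g2 c2 \in a -> K (s *: g1 c1 + t *: g2 c2).
Proof.
move=> cK s0 t0 Gg1 Gg2 c1a c2a nK; set p := _ + _ => pa.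
have /finite_seqP[S SE] : finite_set [set s *: x + t *: y |
    x in [set n c1 | n in stabilizes (G := G) a] &
    y in [set n c2 | n in stabilizes (G := G) a]].
  by apply: finite_image2; exact: (finite_weyl_orbit Gorth Gcompact Ga).
pose f (i : 'I_(size S)) := S`_i.
have fS i : [set` S] (f i) by exact: mem_nth.
have Sf x : [set` S] x -> exists i, f i = x.
  move=> /= xS; have xi : (index x S < size S)%N by rewrite index_mem.
  by exists (Ordinal xi); rewrite /f nth_index.
have fK i : K (f i).
  have := fS i; rewrite -SE => -[_ [n sn <-] [_ [n' sn' <-] <-]]; exact: nK.
have fa i : f i \in a.
  have := fS i; rewrite -SE => -[_ [n sn <-] [_ [n' sn' <-] <-]].
  by rewrite memvD// memvZ// stabilizes_memv.
have max w : w \in a -> exists i, dot w p <= dot w (f i).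
  move=> wa; have [n sn nmax] := weyl_maximizer Gorth Gcompact Ga wa c1a.
  have [n' sn' nmax'] := weyl_maximizer Gorth Gcompact Ga wa c2a.
  have [|i fi] := Sf (s *: n c1 + t *: n' c2).
    by rewrite -SE; exists (n c1); [exists n|exists (n' c2) => //; exists n'].
  exists i; rewrite fi /p !dotDr !dotZr lerD// ler_wpM2l//.
    exact: nmax.
  exact: nmax'.
(* Only the index matters: the family f is not empty. *)
have [i0 _] := max 0 (mem0v a).
have [c c0 c1' w|c [c0 csum ->]] := @finite_separation _ _ dot _ f p _ i0.
  by apply: max; rewrite memvB// memv_suml// => i _; rewrite memvZ.
exact: convex_comb.
Qed.

Lemma weyl_of_stabilizer n : stabilizes (G := G) a n ->
  exists2 w, weyl_group G a w &
    forall x : subvs_of a, vsval (w x) = n (vsval x).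
Proof.
move=> sn; pose w := (linfun (vsproj a) \o n \o linfun (@vsval _ _ a))%VF.
have wE (x : subvs_of a) : vsval (w x) = n (vsval x).
  rewrite /w comp_lfunE comp_lfunE !lfunE/= vsprojK//.
  exact/(stabilizes_memv sn)/subvsP.
by exists w => //; exists n; case: sn.
Qed.

Lemma invariant_mem (A : set V) g v : invariant_convex G A -> G g -> A v ->
  A (g v).
Proof. by move=> [_ HA] Gg Av; rewrite -(HA _ Gg); exists v. Qed.

Lemma trace_invariant_convex (A : set V) : invariant_convex G A ->
  invariant_convex (weyl_group G a) (trace_on a A).
Proof.
move=> GA; split.
  apply/convex_setP => x y t Ax Ay t0 t1.
  by have /convex_setP/(_ (vsval x) (vsval y) t Ax Ay t0 t1) := GA.1.
move=> w [g [Gg ga wg]]; rewrite eqEsubset; split.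
  by move=> _ [x Ax <-]; rewrite /trace_on/= wg; exact: invariant_mem.
move=> y Ay.
have /memv_imgP[v va yv] : vsval y \in (g @: a)%VS by rewrite ga subvsP.
exists (vsproj a v); last by apply: val_inj; rewrite /= wg vsprojK.
rewrite /trace_on/= vsprojK// -(grpVK Gorth v Gg) -yv.
by apply: invariant_mem => //; exact: (grpV Gorth).
Qed.

Lemma cartan_meets v : exists2 g, G g & g v \in a.
Proof. by have [_ [g Gg <-] ga] := Ga.1 v; exists g. Qed.

(** By (A), an invariant set is the union of the G-translates of its trace. *)
Lemma trace_inj (A B : set V) : invariant_convex G A -> invariant_convex G B ->
  trace_on a A = trace_on a B -> A = B.
Proof.
have sub A' B' : invariant_convex G A' -> invariant_convex G B' ->
    trace_on a A' = trace_on a B' -> A' `<=` B'.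
  move=> GA GB AB v Av; have [g Gg ga] := cartan_meets v.
  have : trace_on a A' (vsproj a (g v)).
    by rewrite /trace_on/= vsprojK//; exact: invariant_mem.
  rewrite AB /trace_on/= vsprojK// => Bg.
  rewrite -(grpVK Gorth v Gg).
  by apply: invariant_mem => //; exact: (grpV Gorth).
by move=> GA GB AB; rewrite eqEsubset; split; exact: sub.
Qed.

Lemma convex_vsval (C : set (subvs_of a)) :
  convex_set (C : set (convex_lmodType (subvs_of a))) ->
  convex_set ([set vsval c | c in C] : set (convex_lmodType V)).
Proof.
move=> /convex_setP cC; apply/convex_setP => _ _ t [x Cx <-] [y Cy <-] t0 t1.
exists (t *: x + (1 - t) *: y); first exact: cC.
by rewrite linearD !linearZ.
Qed.

Lemma weyl_invariant (C : set (subvs_of a)) n c :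
  invariant_convex (weyl_group G a) C -> stabilizes (G := G) a n -> C c ->
  exists2 c', C c' & vsval c' = n (vsval c).
Proof.
move=> [_ WC] /weyl_of_stabilizer[w Ww wn] Cc.
by exists (w c); [rewrite -(WC _ Ww); exists c|exact: wn].
Qed.

Lemma trace_surj (C : set (subvs_of a)) :
  invariant_convex (weyl_group G a) C ->
  exists2 A, invariant_convex G A & trace_on a A = C.
Proof.
move=> WC; have cC := convex_vsval WC.1.
pose A := [set v | exists g c, [/\ G g, C c & v = g (vsval c)]].
have Ginv g : G g -> g @` A `<=` A.
  move=> Gg _ [_ [h [c [Gh Cc ->]]] <-]; exists (g \o h)%VF, c.
  by split; [exact: (grpM Gorth)|by []|rewrite comp_lfunE].
exists A; last first.
  rewrite eqEsubset; split=> [x [g [c [Gg Cc xc]]]|c Cc].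
    (* With weights 1 and 0, [weyl_hull] concerns a single orbit: a point g c in a lies in every
       convex set that contains all n c, hence in C. So saturating C by G adds no points in a. *)
    have gca : 1 *: g (vsval c) + 0 *: g (vsval c) \in a.
      by rewrite scale1r scale0r addr0 -xc subvsP.
    have := weyl_hull cC ler01 (lexx 0) Gg Gg (subvsP c) (subvsP c) _ gca.
    rewrite scale1r scale0r addr0 -xc => -[n n' sn sn'|y Cy /val_inj <-//].
    have [c' Cc' c'n] := weyl_invariant WC sn Cc.
    by exists c' => //; rewrite c'n scale1r scale0r addr0.
  by exists \1%VF, c; rewrite id_lfunE; split=> //; exact: (grp1 Gorth).
split.
  apply/convex_setP => v1 v2 t [g1 [c1 [Gg1 Cc1 ->]]].
  move=> [g2 [c2 [Gg2 Cc2 ->]]] t0 t1.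
  (* [weyl_hull] requires a point of a, so the convex combination is moved there by k and back
     afterwards. *)
  set x := _ + _; have [k Gk kx] := cartan_meets x.
  have kxE : k x = t *: (k \o g1)%VF (vsval c1) +
      (1 - t) *: (k \o g2)%VF (vsval c2).
    by rewrite /x linearD !linearZ/= !comp_lfunE.
  have t1' : 0 <= 1 - t by rewrite subr_ge0.
  rewrite kxE in kx.
  have := weyl_hull cC t0 t1' (grpM Gorth Gk Gg1) (grpM Gorth Gk Gg2)
    (subvsP c1) (subvsP c2) _ kx.
  rewrite -kxE => -[n n' sn sn'|c Cc ck].
    have [c1' Cc1' c1n] := weyl_invariant WC sn Cc1.
    have [c2' Cc2' c2n] := weyl_invariant WC sn' Cc2.
    by rewrite -c1n -c2n; have /convex_setP := cC; apply => //;
      [exists c1'|exists c2'].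
  exists (k^-1)%VF, c; split=> //; first exact: (grpV Gorth).
  by rewrite ck (grpVK Gorth).
move=> g Gg; rewrite eqEsubset; split; first exact: Ginv.
move=> v Av; exists ((g^-1)%VF v); last by rewrite (grpKV Gorth).
by apply: (Ginv _ (grpV Gorth Gg)); exists v.
Qed.

Lemma trace_minkowski (A B : set V) :
  invariant_convex G A -> invariant_convex G B ->
  trace_on a (minkowski_add A B) =
  minkowski_add (trace_on a A) (trace_on a B).
Proof.
move=> GA GB; rewrite eqEsubset; split; last first.
  by move=> _ [x Ax [y By <-]]; exists (vsval x) => //; exists (vsval y).
move=> x [v Av [w Bw vw]].
have [k1 Gk1 k1a] := cartan_meets v; have [k2 Gk2 k2a] := cartan_meets w.
have WA := trace_invariant_convex GA; have WB := trace_invariant_convex GB.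
have cK := convex_vsval (convex_minkowski WA.1 WB.1).
(* The summands v and w need not lie in a, but each is a translate of a point of a, so [weyl_hull]
   applies with both weights 1. *)
have E : 1 *: (k1^-1)%VF (k1 v) + 1 *: (k2^-1)%VF (k2 w) = vsval x.
  by rewrite !scale1r !(grpVK Gorth).
have := weyl_hull cK ler01 ler01 (grpV Gorth Gk1) (grpV Gorth Gk2) k1a k2a.
rewrite E => /(_ _ (subvsP x))[n n' sn sn'|y Ky /val_inj <-//].
have n1a := stabilizes_memv sn k1a; have n2a := stabilizes_memv sn' k2a.
exists (vsproj a (n (k1 v)) + vsproj a (n' (k2 w))).
  exists (vsproj a (n (k1 v))); last exists (vsproj a (n' (k2 w))) => //.
    rewrite /trace_on/= vsprojK//.
    by apply: invariant_mem => //; [case: sn|exact: invariant_mem].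
  rewrite /trace_on/= vsprojK//.
  by apply: invariant_mem => //; [case: sn'|exact: invariant_mem].
by rewrite linearD/= !scale1r !vsprojK.
Qed.

End polar.

Theorem proposition1 (R : realType) (V : vectType R) (dot : {dot V for idfun}%R)
    (G : set 'End(V)) (a : {vspace V}) :
  orthogonal_subgroup dot G ->
  compact_endomorphisms G ->
  cartan_subspace dot G a ->
  is_semigroup_iso
    minkowski_add (invariant_convex G)
    minkowski_add (invariant_convex (weyl_group G a))
    (trace_on a).
Proof.
move=> Gorth Gcompact Ga; split; try exact: invariant_convex_semigroup.
- split=> [A|A B /set_mem GA /set_mem GB|C WC].
  + exact: trace_invariant_convex Gorth A.
  + exact: (trace_inj Gorth Ga).
  + by have [A] := trace_surj Gorth Gcompact Ga WC; exists A.
- by move=> A B; exact: (trace_minkowski Gorth Gcompact Ga).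
Qed.
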